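(* Let $K$ be a difference field of characteristic $0$ with $C_K=D_K$, and let $A\in\mathrm{GL}_n(K)$. Then all Picard-Vessiot rings for $\sigma(X)=AX$ over $K$ have the same Krull dimension and the same $m$-invariant.
   Context: A difference ring (field) is a commutative ring with $1$ (a field) with a distinguished automorphism $\sigma$. For a difference ring $S$: $C_S=\{a\in S:\sigma(a)=a\}$, $D_S=\{a\in S:\sigma^m(a)=a\text{ for some }m\neq0\}$. A Picard-Vessiot ring for $\sigma(X)=AX$ over $K$ is a difference ring extension $R'=K[y,\det(y)^{-1}]$ of $K$, with $y\in\mathrm{GL}_n(R')$, $\sigma(y)=Ay$, having no $\sigma$-invariant ideals other than $(0)$ and $R'$. Invariants of a Picard-Vessiot ring $R'$: there are a unique integer $\ell=\ell(R')\ge1$ (the number of primitive idempotents of $R'$) and a decomposition $R'=\bigoplus_{i=0}^{\ell-1}R_i$, $R_i=e_iR'$, where the $e_i=\sigma^i(e_0)$ are the primitive idempotents and each $R_i$ is a domain stable under $\sigma^\ell$. $K$ is identified with its image $e_0K$ in $R_0$. Let $R_0^*$ be the field of fractions of $R_0$, regarded as a $\sigma^\ell$-difference field, so that $C_{R_0^*}$ is the subfield of elements fixed by $\sigma^\ell$ and $D_{R_0^*}$ the subfield of elements fixed by some nonzero power of $\sigma^\ell$. The $m$-invariant of $R'$ is $m(R')=\ell(R')\cdot[D_{R_0^*}:D_KC_{R_0^*}]$. *)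

(* Defs.v *)
From HB Require Import structures.
From mathcomp Require Import all_boot all_order all_algebra.
From mathcomp Require Import boolp classical_sets.

Set Implicit Arguments.
Unset Strict Implicit.
Unset Printing Implicit Defensive.

Import GRing.Theory.

Local Open Scope classical_set_scope.
Local Open Scope ring_scope.

Definition fixed_elements (T : Type) (s : T -> T) : set T :=
  [set a | s a = a].

(* For a bijective s, the exponents m < 0 give nothing more than m > 0. *)
Definition periodic_elements (T : Type) (s : T -> T) : set T :=
  [set a | exists2 m : nat, (0 < m)%N & iter m s a = a].

(* [idealr_closed] ideals are proper by definition, so this says that
   0 and R are the only ideals I with s(I) included in I. *)
Definition difference_simple (R : comNzRingType) (s : R -> R) : Prop :=
  forall I : {pred R}, idealr_closed I -> {in I, forall x, s x \in I} ->
  I =i pred1 0.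

(* d stands for det(y)^-1; R is not assumed to come with an inverse
   operation. *)
Record picard_vessiot (K : fieldType) (sK : {rmorphism K -> K})
    (n : nat) (A : 'M[K]_n)
    (R : comNzRingType) (iota : {rmorphism K -> R})
    (s : {rmorphism R -> R}) : Prop := PicardVessiot {
  pv_bij : bijective s;
  pv_extension : forall a : K, s (iota a) = iota (sK a);
  pv_generated : exists (y : 'M[R]_n) (d : R),
    [/\ \det y * d = 1,
        map_mx s y = map_mx iota A *m y &
        forall S : {pred R}, GRing.subring_closed S ->
          (forall a, iota a \in S) -> (forall i j, y i j \in S) -> d \in S ->
          forall x, x \in S];
  pv_simple : difference_simple s
}.

Definition prime_ideal (R : comNzRingType) (P : {pred R}) : Prop :=
  idealr_closed P /\ prime_idealr_closed P.

Definition prime_chain (R : comNzRingType) (d : nat) (P : nat -> {pred R})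
    : Prop :=
  (forall i, (i <= d)%N -> prime_ideal (P i)) /\
  (forall i, (i < d)%N ->
     {subset P i <= P i.+1} /\ exists2 x, x \in P i.+1 & x \notin P i).

(* [None] stands for infinity, here and in [degree]. *)
Definition krull_dim (R : comNzRingType) : option nat :=
  xget None [set Some d | d in
    [set d | (exists P : nat -> {pred R}, prime_chain d P) /\
             forall d' (P : nat -> {pred R}), prime_chain d' P -> (d' <= d)%N]].

Definition basis_over (F : fieldType) (E D : set F) (n : nat)
    (b : 'I_n -> F) : Prop :=
  [/\ forall i, D (b i),
      forall c : 'I_n -> F, (forall i, E (c i)) -> \sum_i c i * b i = 0 ->
        forall i, c i = 0 &
      forall x, D x -> exists2 c : 'I_n -> F,
        (forall i, E (c i)) & x = \sum_i c i * b i].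

(* The degree [D : E], for subfields E included in D of F. *)
Definition degree (F : fieldType) (E D : set F) : option nat :=
  xget None [set Some n | n in
    [set n | exists b : 'I_n -> F, basis_over E D b]].

Definition compositum (F : fieldType) (E1 E2 : set F) : set F :=
  smallest (fun S : set F => GRing.divring_closed (mem S)) (E1 `|` E2).

Definition primitive_idempotent (R : comNzRingType) (e : R) : Prop :=
  [/\ e * e = e, e != 0 &
      forall f, f * f = f -> e * f = f -> f = 0 \/ f = e].

(* Idempotents e such that the ring eR, whose unit is e, is a domain. *)
Record domain_idempotent (R : comNzRingType) := DomainIdempotent {
  idem_val : R;
  idem_valM : idem_val * idem_val = idem_val;
  idem_val_neq0 : idem_val != 0;
  idem_val_integral : forall x y : R,
    (idem_val * x) * (idem_val * y) = 0 ->
    idem_val * x = 0 \/ idem_val * y = 0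
}.

Section Component.
Variables (R : comNzRingType) (e : domain_idempotent R).

(* The ring eR, as the set of x with e x = x. *)
Record component := Component {
  component_val : R;
  component_valP : idem_val e * component_val == component_val
}.

HB.instance Definition _ := [isSub for component_val].
HB.instance Definition _ := [Choice of component by <:].

Fact proj_subproof (x : R) : idem_val e * (idem_val e * x) == idem_val e * x.
Proof. by rewrite mulrA idem_valM. Qed.
Definition proj (x : R) : component := Component (proj_subproof x).

Lemma compE (x : component) : idem_val e * val x = val x.
Proof. exact/eqP/component_valP. Qed.

Lemma val_proj (x : R) : val (proj x) = idem_val e * x. Proof. by []. Qed.

Definition comp_add (x y : component) := proj (val x + val y).
Definition comp_opp (x : component) := proj (- val x).
Definition comp_mul (x y : component) := proj (val x * val y).

Let val_add x y : val (comp_add x y) = val x + val y.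
Proof. by rewrite val_proj mulrDr !compE. Qed.
Let val_opp x : val (comp_opp x) = - val x.
Proof. by rewrite val_proj mulrN compE. Qed.
Let val_mul x y : val (comp_mul x y) = val x * val y.
Proof. by rewrite val_proj mulrA compE. Qed.
Let val_0 : val (proj 0) = 0. Proof. by rewrite val_proj mulr0. Qed.
Let val_1 : val (proj 1) = idem_val e. Proof. by rewrite val_proj mulr1. Qed.

Fact comp_addA : associative comp_add.
Proof. by move=> x y z; apply: val_inj; rewrite !val_add addrA. Qed.
Fact comp_addC : commutative comp_add.
Proof. by move=> x y; apply: val_inj; rewrite !val_add addrC. Qed.
Fact comp_add0 : left_id (proj 0) comp_add.
Proof. by move=> x; apply: val_inj; rewrite val_add val_0 add0r. Qed.
Fact comp_addN : left_inverse (proj 0) comp_opp comp_add.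
Proof. by move=> x; apply: val_inj; rewrite val_add val_opp val_0 addNr. Qed.

HB.instance Definition _ :=
  GRing.isZmodule.Build component comp_addA comp_addC comp_add0 comp_addN.

Fact comp_mulA : associative comp_mul.
Proof. by move=> x y z; apply: val_inj; rewrite !val_mul mulrA. Qed.
Fact comp_mulC : commutative comp_mul.
Proof. by move=> x y; apply: val_inj; rewrite !val_mul mulrC. Qed.
Fact comp_mul1 : left_id (proj 1) comp_mul.
Proof. by move=> x; apply: val_inj; rewrite val_mul val_1 compE. Qed.
Fact comp_mulD : left_distributive comp_mul +%R.
Proof.
by move=> x y z; apply: val_inj; rewrite !(val_mul, val_add) mulrDl.
Qed.
Fact comp_1neq0 : proj 1 != 0.
Proof.
apply/eqP => /(congr1 val); rewrite val_1 [RHS]val_0 => e0.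
by have := idem_val_neq0 e; rewrite e0 eqxx.
Qed.

HB.instance Definition _ := GRing.Zmodule_isComNzRing.Build component
  comp_mulA comp_mulC comp_mul1 comp_mulD comp_1neq0.

Definition comp_unit : {pred component} :=
  fun x => `[< exists y : component, y * x = 1 >].
Definition comp_inv (x : component) : component :=
  xget x [set y | y * x = 1].

Fact comp_mulV : {in comp_unit, left_inverse 1 comp_inv *%R}.
Proof. by move=> x /asboolP xU; have := xgetPex x xU. Qed.
Fact comp_unitP (x y : component) : y * x = 1 -> comp_unit x.
Proof. by move=> yx; apply/asboolP; exists y. Qed.
Fact comp_inv_out : {in [predC comp_unit], comp_inv =1 id}.
Proof.
move=> x /negP xNU; apply: xgetPN => y yx; apply: xNU.
exact: comp_unitP yx.
Qed.

HB.instance Definition _ := GRing.ComNzRing_hasMulInverse.Build component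
  comp_mulV comp_unitP comp_inv_out.

Fact comp_integral : GRing.integral_domain_axiom component.
Proof.
move=> x y /(congr1 val); rewrite [LHS]val_mul [RHS]val_0 => xy0.
have := @idem_val_integral _ e (val x) (val y); rewrite !compE => /(_ xy0).
by case=> z0; apply/orP; [left | right]; apply/eqP/val_inj;
  rewrite [RHS]val_0.
Qed.

HB.instance Definition _ := GRing.ComUnitRing_isIntegral.Build component
  comp_integral.

End Component.

Local Notation "x %:F" := (@FracField.tofrac _ x).

(* The extension x / y |-> f x / f y of f to the fields of fractions,
   computed on representatives; see [frac_mapE]. *)
Definition frac_map (D1 D2 : idomainType) (f : D1 -> D2) (x : {fraction D1})
    : {fraction D2} :=
  (f (\n_(repr x)))%:F / (f (\d_(repr x)))%:F.

Lemma frac_mapE (D1 D2 : idomainType) (f : {rmorphism D1 -> D2}) (a b : D1) :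
  injective f -> b != 0 ->
  frac_map f (a%:F / b%:F) = (f a)%:F / (f b)%:F.
Proof.
move=> f_inj b0.
have fF0 (c : D1) : c != 0 -> (f c)%:F != 0.
  by move=> c0; rewrite tofrac_eq0 -(rmorph0 f) (inj_eq f_inj).
rewrite /frac_map; set x := a%:F / b%:F; set r := repr x.
have r0 : \d_r != 0 by apply: denom_ratioP.
have xE : x = (\n_r)%:F / (\d_r)%:F.
  apply/(canRL (mulfK _)); first by rewrite tofrac_eq0.
  rewrite -[x]reprK -/r; unlock FracField.tofrac.
  rewrite -[LHS]FracField.pi_mul; apply/eqP; rewrite FracField.equivf_def.
  by rewrite /FracField.mulf !numden_Ratio ?mulf_neq0 ?oner_neq0 // !mulr1 mulrC.
apply/eqP; rewrite eqr_div ?fF0 // -!rmorphM tofrac_eq (inj_eq f_inj).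
by rewrite -tofrac_eq !rmorphM -eqr_div ?tofrac_eq0 // -xE.
Qed.

Section Invariants.
Variables (K : fieldType) (sK : {rmorphism K -> K}).
Variables (R : comNzRingType) (iota : {rmorphism K -> R}).
Variable s : {rmorphism R -> R}.

(* The decomposition of R as the direct sum of the e_i R for i < l, where
   the e_i = s^i(e) are the primitive idempotents of R and e_i R is a domain.
   As s is an automorphism, it suffices to have the latter for e_0 = e, which
   is part of the type of e. *)
Record idempotent_decomposition (l : nat) (e : domain_idempotent R) : Prop :=
  IdempotentDecomposition {
  decomp_gt0 : (0 < l)%N;
  decomp_primitive : forall f : R,
    primitive_idempotent f <-> exists2 i, (i < l)%N & f = iter i s (idem_val e);
  decomp_ortho : forall i j, (i < l)%N -> (j < l)%N -> i != j ->
    iter i s (idem_val e) * iter j s (idem_val e) = 0;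
  decomp_sum : \sum_(i < l) iter i s (idem_val e) = 1;
  decomp_stable : iter l s (idem_val e) = idem_val e
}.

(* The map induced by s^l on the field of fractions of eR; when s^l(e) = e,
   the multiplication by e in [proj] has no effect. *)
Definition component_frac_map (l : nat) (e : domain_idempotent R) :
    {fraction component e} -> {fraction component e} :=
  frac_map (fun x : component e => proj e (iter l s (val x))).

Definition base_in_frac (e : domain_idempotent R) (a : K) :
    {fraction component e} := (proj e (iota a))%:F.

(* l [D_L : D_K C_L], where L is the field of fractions of eR. *)
Definition m_value (l : nat) (e : domain_idempotent R) : option nat :=
  let sl := component_frac_map l (e := e) in
  omap (muln l)
    (degree
       (compositum (@base_in_frac e @` periodic_elements sK)
                   (fixed_elements sl))
       (periodic_elements sl)).

(* m is the m-invariant of R: the decomposition exists and yields m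
   for any choice of e_0. *)
Definition is_m_invariant (m : option nat) : Prop :=
  (exists l (e : domain_idempotent R), idempotent_decomposition l e) /\
  forall l (e : domain_idempotent R), idempotent_decomposition l e ->
    m_value l e = m.

End Invariants.

(* Main.v *)
Require Import Defs.
From HB Require Import structures.
From mathcomp Require Import all_boot all_order all_algebra.
From mathcomp Require Import boolp classical_sets ring.
From mathcomp Require Import finmap monalg.

(* The m-invariant of a Picard-Vessiot ring R is the dimension of the ring of
   its periodic elements over its field of constants C_R: the periodic elements
   of the fraction field of a component R_0 already lie in R_0, and D_K = C_K
   disappears in the compositum with the constants.

   Two Picard-Vessiot rings R1 and R2 for the same equation embed into a
   difference-simple quotient S of their tensor product over K, where their
   fundamental matrices differ by a matrix Z of constants.  So S is generated by
   constants over each of them.  By linear disjointness of constants, S is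
   R_i (x) L over C_{R_i}, where L is the field of constants of S, and L is
   generated by finitely many elements over C_{R_i}, hence algebraic over it by
   Zariski's lemma.  Thus S is integral over R1 and R2, which gives the equality
   of the Krull dimensions, and the periodic elements of S are obtained from
   those of R_i by extension of scalars from C_{R_i} to L.

   The decomposition of R into domains is obtained from a maximal annihilator
   of R, a prime ideal which is periodic by noetherianity: the intersections of
   all but one of its conjugates sum up to a nonzero difference ideal. *)

Set Implicit Arguments.
Unset Strict Implicit.
Unset Printing Implicit Defensive.

Import GRing.Theory.

Local Open Scope classical_set_scope.
Local Open Scope ring_scope.

(** * Ideals *)

(** The constants need not be algebraically closed, so [R1] and [R2] need not be isomorphic, and the
    two factors of the m-invariant cannot be compared separately. Over the rationals with the
    identity, sigma(y) = -y has the Picard-Vessiot rings Q[y]/(y^2 - 1), with two components and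
    degree 1, and Q[y]/(y^2 - 2), a field with degree 2. Counting the periodic elements of the whole
    ring over its constants merges both factors: the endomorphism permutes the [l] components
    cyclically, and a periodic element is an arbitrary family of [l] periodic elements, one in each
    component. This dimension also makes sense for [S], where no decomposition has to be known, and
    its value there is the common m-invariant. It may be infinite, so finiteness has to be
    transferred in both directions at every comparison. *)

Definition submodule_over (R : comNzRingType) (A J : set R) : Prop :=
  J 0 /\ forall a u v, A a -> J u -> J v -> J (a * u + v).

Local Notation ideal := (submodule_over setT).

Definition asbool_pred (T : Type) (J : set T) : {pred T} := fun x => `[< J x >].

Lemma asbool_predE (T : Type) (J : set T) x : x \in asbool_pred J <-> J x.
Proof. by split=> [/asboolP|Jx]; [|apply/asboolP]. Qed.

Section Ideals.
Variable R : comNzRingType.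
Implicit Types (A J G M : set R).

Lemma ideal_zero J : ideal J -> J 0. Proof. by case. Qed.

Lemma ideal_muladd J a u v : ideal J -> J u -> J v -> J (a * u + v).
Proof. by case=> _; apply. Qed.

Lemma ideal_add J u v : ideal J -> J u -> J v -> J (u + v).
Proof. by move=> iJ Ju Jv; rewrite -[u]mul1r; apply: ideal_muladd. Qed.

Lemma ideal_mull J a u : ideal J -> J u -> J (a * u).
Proof.
by move=> iJ Ju; rewrite -[_ * _]addr0; apply: ideal_muladd => //;
  apply: ideal_zero.
Qed.

Lemma ideal_mulr J a u : ideal J -> J u -> J (u * a).
Proof. by rewrite mulrC; apply: ideal_mull. Qed.

Lemma ideal_opp J u : ideal J -> J u -> J (- u).
Proof. by move=> iJ Ju; rewrite -mulN1r; apply: ideal_mull. Qed.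

Lemma ideal_sub J u v : ideal J -> J u -> J v -> J (u - v).
Proof. by move=> iJ Ju Jv; apply: ideal_add => //; apply: ideal_opp. Qed.

Lemma ideal_sum J (I : Type) (r : seq I) (P : pred I) (F : I -> R) :
  ideal J -> (forall i, P i -> J (F i)) -> J (\sum_(i <- r | P i) F i).
Proof.
move=> iJ JF; apply: big_ind => //; first exact: ideal_zero.
by move=> u v; apply: ideal_add.
Qed.

Lemma ideal_prod J (I : finType) (F : I -> R) (i : I) :
  ideal J -> J (F i) -> J (\prod_j F j).
Proof. by move=> iJ Ji; rewrite (bigD1 i) //=; apply: ideal_mulr. Qed.

Lemma idealrP (J : set R) :
  ideal J -> ~ J 1 -> idealr_closed (asbool_pred J).
Proof.
move=> iJ J1; split; first by apply/asbool_predE; case: iJ.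
- by apply/negP => /asbool_predE.
- move=> a u v /asbool_predE Ju /asbool_predE Jv; apply/asbool_predE.
  exact: ideal_muladd.
Qed.

Lemma idealr_ideal (J : {pred R}) :
  idealr_closed J -> ideal [set x | x \in J].
Proof. by case=> J0 _ JDM; split=> // a u v _ Ju Jv; apply: JDM. Qed.

Definition gen_ideal G : set R := [set x | forall J,
  ideal J -> G `<=` J -> J x].

Lemma gen_ideal_ideal G : ideal (gen_ideal G).
Proof.
split=> [J iJ _|a u v _ Gu Gv J iJ GJ]; first exact: ideal_zero.
by apply: ideal_muladd => //; [apply: Gu | apply: Gv].
Qed.

Lemma sub_gen_ideal G : G `<=` gen_ideal G.
Proof. by move=> x Gx J _; apply. Qed.

Lemma gen_ideal_min G J : ideal J -> G `<=` J -> gen_ideal G `<=` J.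
Proof. by move=> iJ GJ x; apply. Qed.

Lemma gen_idealS G1 G2 : G1 `<=` G2 -> gen_ideal G1 `<=` gen_ideal G2.
Proof.
move=> G12; apply: gen_ideal_min; first exact: gen_ideal_ideal.
by apply: subset_trans G12 _; apply: sub_gen_ideal.
Qed.

(** One use of Zorn's lemma for three purposes: maximal proper difference ideals ([f = s], [M =
    [set 1]]), lying over ([M] the image of the complement of a prime), and hyperplanes avoiding [1]
    ([A] the image of a field). *)
Lemma maximal_submodule A (f : R -> R) M J0 :
  submodule_over A J0 -> (forall x, J0 x -> J0 (f x)) -> J0 `&` M `<=` set0 ->
  exists J, [/\ submodule_over A J, forall x, J x -> J (f x), J `&` M `<=` set0,
    J0 `<=` J &
    forall J', submodule_over A J' -> (forall x, J' x -> J' (f x)) ->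
      J' `&` M `<=` set0 -> J `<=` J' -> J' `<=` J].
Proof.
move=> sJ0 fJ0 J0M.
pose good J := [/\ submodule_over A J, forall x, J x -> J (f x),
  J `&` M `<=` set0 &
                   J0 `<=` J].
have good0 : good J0 by split.
have [F FP totF|J [[JE|[sJ fJ JM J0J]] Jmax]] :=
    @Zorn_bigcup _ (fun J => J = set0 \/ good J).
- have [[J1 FJ1 gJ1]|Fset0] := pselect (exists2 J, F J & good J); last first.
    left; apply/seteqP; split=> // x [J FJ Jx]; case: (FP _ FJ) => [JE|gJ].
      by rewrite JE in Jx.
    by exfalso; apply: Fset0; exists J.
  right; split.
  + split; first by exists J1 => //; case: gJ1 => -[].
    move=> a u v Aa [Ju FJu Juu] [Jv FJv Jvv].
    have goodF J x : F J -> J x -> good J.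
      by move=> FJ Jx; case: (FP _ FJ) => // JE; rewrite JE in Jx.
    case: (totF _ _ FJu FJv) => [uv|vu].
      have [[_ sJ] _ _ _] := goodF _ _ FJv Jvv.
      by exists Jv => //; apply: sJ => //; apply: uv.
    have [[_ sJ] _ _ _] := goodF _ _ FJu Juu.
    by exists Ju => //; apply: sJ => //; apply: vu.
  + move=> x [J FJ Jx]; case: (FP _ FJ) => [JE|[_ fJ _ _]].
      by rewrite JE in Jx.
    by exists J => //; apply: fJ.
  + move=> x [[J FJ Jx] Mx]; case: (FP _ FJ) => [JE|[_ _ JM _]].
      by rewrite JE in Jx.
    exact: (JM x).
  + by case: gJ1 => _ _ _ J01 x J0x; exists J1 => //; apply: J01.
- have [] := Jmax J0 _ (or_intror good0); rewrite JE.
  by split=> // /(_ 0); apply; case: sJ0.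
- exists J; split=> // J' sJ' fJ' J'M JJ' x J'x; apply: contrapT => nJx.
  apply: (Jmax J'); last by right; split=> //; apply: subset_trans JJ'.
  by split=> // J'J; apply/nJx/J'J.
Qed.

(** * Noetherian rings *)

Definition noetherian : Prop := forall J, ideal J ->
  exists l : seq R, (forall x, x \in l -> J x) /\ J `<=` gen_ideal [set` l].

(** The ideals of the initial segments increase; the finitely many generators of their union all lie
    in some stage [k], whose ideal then contains [x k]. *)
Lemma noetherian_sequence (x : nat -> R) : noetherian ->
  exists k, gen_ideal [set x i | i in [set i | (i < k)%N]] (x k).
Proof.
pose G k := [set x i | i in [set i | (i < k)%N]].
move=> /(_ [set y | exists k, gen_ideal (G k) y])[].
  split; first by exists 0%N; exact: (ideal_zero (gen_ideal_ideal _)).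
  move=> a u v _ [i Gu] [j Gv]; exists (maxn i j).
  apply: (ideal_muladd _ (gen_ideal_ideal _)).
    apply: (gen_idealS _ Gu) => _ [k /= ki <-]; exists k => //=.
    by rewrite leq_max ki.
  apply: (gen_idealS _ Gv) => _ [k /= kj <-]; exists k => //=.
  by rewrite leq_max kj orbT.
move=> l [lJ Jl].
have [k kP] : exists k, forall y, y \in l -> gen_ideal (G k) y.
  elim: l lJ {Jl} => [|y l IH] lJ; first by exists 0%N.
  have [|k kP] := IH; first by move=> z zl; apply: lJ; rewrite inE zl orbT.
  have [k' k'P] := lJ y (mem_head _ _).
  exists (maxn k k') => z; rewrite inE => /predU1P[->|/kP].
    apply: (gen_idealS _ k'P) => _ [i /= ik <-]; exists i => //=.
    by rewrite leq_max ik orbT.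
  by apply: gen_idealS => _ [i /= ik <-]; exists i => //=; rewrite leq_max ik.
exists k; apply: (@gen_ideal_min [set` l]); first exact: gen_ideal_ideal.
  by move=> y /=; apply: kP.
apply: Jl; exists k.+1; apply: sub_gen_ideal; exists k => //=.
Qed.

End Ideals.

Lemma preimage_ideal (R S : comNzRingType) (f : {rmorphism R ->
  S}) (J : set S) :
  ideal J -> ideal (f @^-1` J).
Proof.
move=> iJ; split=> [|a u v _ Ju Jv]; first by rewrite /preimage /= rmorph0;
  apply: ideal_zero.
by rewrite /preimage /= rmorphD rmorphM; apply: ideal_muladd.
Qed.

Lemma noetherian_surjection (R S : comNzRingType) (f : {rmorphism R -> S}) :
  (forall y, exists x, f x = y) -> noetherian R -> noetherian S.
Proof.
move=> f_surj nR J iJ; have [l [lJ Jl]] := nR _ (preimage_ideal f iJ).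
exists (map f l); split=> [_ /mapP[x xl ->]|y Jy]; first exact: lJ.
have [x fx] := f_surj y; rewrite -fx in Jy *.
have := Jl x Jy; apply: (@gen_ideal_min _ _ (f @^-1` gen_ideal [set` map f l])).
  exact: (preimage_ideal _ (gen_ideal_ideal _)).
by move=> z /= zl; apply: sub_gen_ideal; rewrite /= map_f.
Qed.

Lemma noetherian_field (K : fieldType) : noetherian K.
Proof.
move=> J iJ; have [[x Jx x0]|J0] := pselect (exists2 x, J x & x != 0).
  exists [:: x]; split=> [y|y _]; first by rewrite inE => /eqP->.
  rewrite -[y](mulfVK x0); apply: (ideal_mull _ (gen_ideal_ideal _)).
  by apply: sub_gen_ideal; rewrite /= inE.
exists [::]; split=> // y Jy; apply: contrapT => ny; apply: J0; exists y => //.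
by apply: contra_notN ny => /eqP->; exact: (ideal_zero (gen_ideal_ideal _)).
Qed.

(* Hilbert's basis theorem: if the ideal [J] of A[X] were not finitely
   generated, one could pick f_0, f_1, ..., each of minimal degree among the
   elements of [J] outside the ideal of its predecessors; but the leading
   coefficient of some f_k is in the ideal of the previous ones. *)
Lemma noetherian_poly (A : comNzRingType) : noetherian A -> noetherian {poly A}.
Proof.
move=> nA J iJ; apply: contrapT => Jnfg.
have pickP (l : seq {poly A}) : exists f : {poly A},
    (forall g, g \in l -> J g) -> [/\ J f, ~ gen_ideal [set` l] f &
      forall g : {poly A},
        J g -> ~ gen_ideal [set` l] g -> (size f <= size g)%N].
  have [lJ|] := pselect (forall g, g \in l -> J g); last by exists 0.
  have [f0 Jf0 f0l] : exists2 f, J f & ~ gen_ideal [set` l] f.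
    apply: contrapT => Jl; apply: Jnfg; exists l; split=> // f Jf.
    by apply: contrapT => fl; apply: Jl; exists f.
  pose P n := `[< exists f : {poly A},
    [/\ J f, ~ gen_ideal [set` l] f & size f = n] >].
  have exP : exists n, P n by exists (size f0); apply/asboolP; exists f0.
  have [_ /asboolP[f [Jf fl <-]] fmin] := ex_minnP exP.
  exists f => _; split=> // g Jg gl.
  by apply: fmin; apply/asboolP; exists g.
have /boolp.choice[pick {}pickP] := pickP.
pose l := fix l n := if n is m.+1 then rcons (l m) (pick (l m)) else [::].
have lJ n : forall g, g \in l n -> J g.
  elim: n => // n IH g; rewrite /= mem_rcons inE => /predU1P[->|/IH//].
  by have [] := pickP _ IH.
pose f n := pick (l n).
have fJ n : J (f n) by have [] := pickP _ (lJ n).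
have fnl n : ~ gen_ideal [set` l n] (f n) by have [] := pickP _ (lJ n).
have fmin n (g : {poly A}) : J g -> ~ gen_ideal [set` l n] g ->
  (size (f n) <= size g)%N.
  by have [_ _] := pickP _ (lJ n); apply.
have fl i n : (i < n)%N -> f i \in l n.
  elim: n => // n IH; rewrite ltnS leq_eqVlt /= mem_rcons inE.
  by case/predU1P=> [->|/IH->]; rewrite ?eqxx ?orbT.
have f_homo i n : (i <= n)%N -> (size (f i) <= size (f n))%N.
  move=> ilen; apply: fmin => // fnli; apply: (fnl n).
  apply: gen_idealS fnli => g /=; elim: (n) ilen => [|m IH].
    by rewrite leqn0 => /eqP->.
  rewrite leq_eqVlt => /predU1P[-> //|]; rewrite ltnS => /IH{}IH /IH gl.
  by rewrite /= mem_rcons inE gl orbT.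
have f0 n : (0 < size (f n))%N.
  rewrite size_poly_gt0; apply: contra_notN (@fnl n) => /eqP->.
  exact: (ideal_zero (gen_ideal_ideal _)).
have [k kP] := noetherian_sequence (fun n => lead_coef (f n)) nA.
pose d := (size (f k)).-1.
have dk : d.+1 = size (f k) by rewrite prednK.
have [g [gG gd gs]] : exists g : {poly A}, [/\ gen_ideal [set` l k] g,
    g`_d = lead_coef (f k) & (size g <= d.+1)%N].
  (* [gen_ideal] quantifies over all ideals, so [kP] can be applied to the ideal of coefficients at
     ['X^d] of the elements of degree at most [d] in the ideal of [l k]. *)
  move: (kP [set a | exists g : {poly A}, [/\ gen_ideal [set` l k] g,
    g`_d = a & (size g <= d.+1)%N]]); apply.
    split.
      exists 0; rewrite coef0 size_poly0; split=> //.
      exact: (ideal_zero (gen_ideal_ideal _)).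
    move=> a _ _ _ [g1 [g1G <- s1]] [g2 [g2G <- s2]].
    exists (a%:P * g1 + g2); split.
    - exact: (ideal_muladd _ (gen_ideal_ideal _)).
    - by rewrite coefD coefCM.
    - apply: leq_trans (size_polyD _ _) _; rewrite geq_max s2 andbT.
      by rewrite mul_polyC (leq_trans (size_scale_leq _ _)).
  move=> _ [i /= ik <-].
  have di : ((size (f i)).-1 <= d)%N.
    by rewrite -ltnS prednK // dk; apply/f_homo/ltnW.
  exists ('X^(d - (size (f i)).-1) * f i); split.
  - apply: (ideal_mull _ (gen_ideal_ideal _)); apply: sub_gen_ideal.
    exact: fl.
  - by rewrite mulrC coefMXn ltnNge leq_subr /= subKn.
  - apply: leq_trans (size_polyMleq _ _) _.
    by rewrite size_polyXn /= -(prednK (f0 i)) addnS /= subnK.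
have : (size (f k) <= size (f k - g)%R)%N.
  apply: fmin => [|fg].
    apply: ideal_sub => //; apply: (gen_ideal_min _ _ gG) => // h /=; exact: lJ.
  apply: (@fnl k); rewrite -(subrK g (f k)).
  exact: (ideal_add (gen_ideal_ideal _)).
rewrite leqNgt -dk ltnS => /negP; apply.
apply/leq_sizeP => j; rewrite leq_eqVlt => /predU1P[<-|dj].
  by rewrite coefB gd lead_coefE subrr.
rewrite coefB !nth_default ?subrr // -?dk //.
exact: leq_trans gs dj.
Qed.

(** Induction on [l] builds an iterated polynomial ring over [K] with one variable per element of
    [l]; the image of its evaluation is a subring containing all generators. *)
Lemma noetherian_generated (K : fieldType) (R : comNzRingType)
    (iota : {rmorphism K -> R}) (l : seq R) :
  (forall S : {pred R}, GRing.subring_closed S -> (forall a, iota a \in S) ->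
     {subset l <= S} -> forall x, x \in S) ->
  noetherian R.
Proof.
move=> genR.
have [T [f [nT fi fl]]] : exists (T : comNzRingType) (f : {rmorphism T -> R}),
    [/\ noetherian T, forall a, exists x, f x = iota a &
        forall y, y \in l -> exists x, f x = y].
  elim: l {genR} => [|z l [T [f [nT fi fl]]]].
    by exists K, iota; split=> //; [apply: noetherian_field | move=> a;
      exists a].
  pose g := horner_morph (fun x => mulrC z (f x)).
  exists {poly T}, g; split; first exact: noetherian_poly.
    by move=> a; have [x <-] := fi a; exists x%:P; exact: horner_morphC.
  move=> y; rewrite inE => /predU1P[->|/fl[x <-]].
    by exists 'X; exact: horner_morphX.
  by exists x%:P; exact: horner_morphC.
apply: (noetherian_surjection (f := f)) nT => y.
apply/(asbool_predE [set y | exists x, f x = y]); apply: genR.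
- split; first by apply/asbool_predE; exists 1; rewrite rmorph1.
    move=> _ _ /asbool_predE[x <-] /asbool_predE[x' <-].
    by apply/asbool_predE; exists (x - x'); rewrite rmorphB.
  move=> _ _ /asbool_predE[x <-] /asbool_predE[x' <-].
  by apply/asbool_predE; exists (x * x'); rewrite rmorphM.
- by move=> a; apply/asbool_predE.
- by move=> z zl; apply/asbool_predE/fl.
Qed.

Lemma noetherian_pv (K : fieldType) (sK : {rmorphism K -> K})
    (n : nat) (A : 'M[K]_n) (R : comNzRingType) (iota : {rmorphism K -> R})
    (s : {rmorphism R -> R}) :
  picard_vessiot sK A iota s -> noetherian R.
Proof.
case=> _ _ [y [d [_ _ gen]]] _.
apply: (@noetherian_generated _ _ iota (d :: [seq y i j | i <- enum 'I_n,
  j <- enum 'I_n])).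
move=> S Ssub Si Sl; apply: gen => // [i j|]; apply: Sl; last exact: mem_head.
by rewrite inE; apply/orP; right; apply: allpairs_f; rewrite mem_enum.
Qed.

(** * Difference-simple rings *)

Section DifferenceSimple.
Variables (R : comNzRingType) (s : {rmorphism R -> R}).
Hypothesis s_simple : difference_simple s.

Lemma simple_ideal1 (J : set R) x :
  ideal J -> (forall y, J y -> J (s y)) -> J x -> x != 0 -> J 1.
Proof.
move=> iJ sJ Jx x0; apply: contrapT => J1.
have sJ' : {in asbool_pred J, forall y, s y \in asbool_pred J}.
  by move=> y /asbool_predE/sJ/asbool_predE.
have := s_simple (idealrP iJ J1) sJ' x; rewrite [RHS]inE (negPf x0).
by move/negP; apply; apply/asbool_predE.
Qed.

Lemma simple_ideal0 (J : set R) x :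
  ideal J -> (forall y, J y -> J (s y)) -> ~ J 1 -> J x -> x = 0.
Proof.
move=> iJ sJ J1 Jx; have [//|x0] := eqVneq x 0.
by case: J1; apply: simple_ideal1 Jx x0.
Qed.

Lemma simple_inj (S : comNzRingType) (sS : {rmorphism S -> S})
    (j : {rmorphism R -> S}) :
  (forall x, j (s x) = sS (j x)) -> injective j.
Proof.
move=> js; apply: raddf_inj => x jx; apply: (@simple_ideal0 [set y | j y =
  0]) => //.
- split=> [|a u v _ /= ju jv]; first exact: rmorph0.
  by rewrite rmorphD rmorphM ju jv mulr0 addr0.
- by move=> y /= jy; rewrite js jy rmorph0.
- by rewrite /= rmorph1; apply/eqP/oner_neq0.
Qed.

End DifferenceSimple.

(** * Decomposition of a difference-simple noetherian ring into domains *)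

Section IdempotentDecomposition.
Variables (R : comNzRingType) (s : {rmorphism R -> R}).
Hypothesis (s_simple : difference_simple s) (s_bij : bijective s).
Hypothesis (R_noeth : noetherian R).

Let ann (x : R) : set R := [set a | a * x = 0].

Let ann_ideal x : ideal (ann x).
Proof.
rewrite /ann; split=> [|a u v _ /= ux vx]; first exact: mul0r.
by rewrite mulrDl -mulrA ux vx mulr0 addr0.
Qed.

Lemma maximal_annihilator :
  exists2 x, x != 0 & forall y, y != 0 -> ann x `<=` ann y -> ann y `<=` ann x.
Proof.
apply: contrapT => nmax.
(* [p.1] has a strictly larger annihilator, as [p.2] witnesses. Along the iteration from [1], the
   earlier witnesses kill the current element and the current witness does not, against
   [noetherian_sequence]. *)
have stepP x : exists p : R * R, x != 0 ->
    [/\ p.1 != 0, ann x `<=` ann p.1, ann p.1 p.2 & ~ ann x p.2].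
  have [->|x0] := eqVneq x 0; first by exists 0.
  apply: contrapT => nx; apply: nmax; exists x => // y y0 xy a ya.
  by apply: contrapT => xa; apply: nx; exists (y, a).
have {stepP} /boolp.choice[step stepP] := stepP.
pose x n := iter n (fun y => (step y).1) 1.
have x0 n : x n != 0.
  by elim: n => [|n IH]; [apply: oner_neq0 | have [] := stepP _ IH].
have annS n m : (n <= m)%N -> ann (x n) `<=` ann (x m).
  elim: m => [|m IH]; first by rewrite leqn0 => /eqP->.
  rewrite leq_eqVlt => /predU1P[-> //|]; rewrite ltnS => /IH{}IH.
  by have [_ xS _ _] := stepP _ (x0 m); apply: subset_trans xS.
have [k kP] := noetherian_sequence (fun n => (step (x n)).2) R_noeth.
have [_ _ _] := stepP _ (x0 k); apply; apply: kP => // _ [i /= ik <-].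
by have [_ _ + _] := stepP _ (x0 i); apply: (annS i.+1).
Qed.

Lemma idempotent_decomposition_exists :
  exists l (e : domain_idempotent R), idempotent_decomposition s l e.
Proof.
have [x x0 xmax] := maximal_annihilator.
have s_inj : injective s by apply: (simple_inj s_simple (sS := s)).
have [t sK tK] := s_bij.
pose Q i := ann (iter i s x).
have xi0 i : iter i s x != 0.
  by elim: i => //= i IH; rewrite -(rmorph0 s) (inj_eq s_inj).
have QS i a : Q i.+1 (s a) <-> Q i a.
  rewrite /Q /ann /= -rmorphM; split=> [|->]; last exact: rmorph0.
  by rewrite -{1}(rmorph0 s) => /s_inj.
have QE i j k : (forall a, Q i a <-> Q j a) -> forall a,
  Q (k + i)%N a <-> Q (k + j)%N a.
  move=> Qij; elim: k => [//|k IH] a.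
  by rewrite -(tK a) !addSn !QS.
have QEV i j k : (forall a, Q (k + i)%N a <-> Q (k + j)%N a) ->
    forall a, Q i a <-> Q j a.
  elim: k => [//|k IH] Qij; apply: IH => a.
  by rewrite -QS -[X in _ <-> X]QS; apply: Qij.
have Qmax i y : y != 0 -> Q i `<=` ann y -> ann y `<=` Q i.
  elim: i y => [|i IH] y y0 Qy; first exact: xmax.
  have ty0 : t y != 0 by rewrite -(inj_eq s_inj) tK rmorph0.
  move=> a ay; rewrite -(tK a); apply/QS; apply: (IH _ ty0).
    by move=> b /QS/Qy by0; apply: s_inj; rewrite rmorphM tK rmorph0.
  by apply: s_inj; rewrite rmorphM !tK rmorph0.
(* If [b] does not kill [s^i x], the annihilator of [b * s^i x] contains [Q i], hence equals it by
   maximality. *)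
have Qprime i a b : Q i (a * b) -> Q i a \/ Q i b.
  move=> Qab; have [Qb|bx0] := eqVneq (b * iter i s x) 0; first by right.
  left; apply: (Qmax i _ bx0); last by rewrite /ann /= mulrA.
  by move=> c; rewrite /ann /= mulrCA => ->; rewrite mulr0.
have Q1 i : ~ Q i 1 by rewrite /Q /ann /= mul1r; apply/eqP.
have Qi i : ideal (Q i) by apply: ann_ideal.
have Qprod i (I : finType) (P : pred I) (F : I -> R) :
    (forall j, P j -> ~ Q i (F j)) -> ~ Q i (\prod_(j | P j) F j).
  move=> QF; apply: (big_ind (fun y => ~ Q i y)) => // a b Qa Qb.
  by case/Qprime.
have Qle i j : Q i `<=` Q j -> forall a, Q i a <-> Q j a.
  by move=> Qij a; split; [apply: Qij | apply: Qmax].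
(* Some [s^k x] is in the ideal of the earlier [s^i x]. Elements of [Q i] outside [Q k], one for
   each [i < k], would have a product killing all these [s^i x], hence [s^k x], against the
   primality of [Q k]. *)
have perQ : exists p, (0 < p)%N && `[< forall a, Q 0%N a <-> Q p a >].
  have [k kP] := noetherian_sequence (fun n => iter n s x) R_noeth.
  have [i ik Qik] : exists2 i, (i < k)%N & Q i `<=` Q k.
    apply: contrapT => nQ.
    have [i|a aP] := @boolp.choice 'I_k R (fun i a => Q i a /\ ~ Q k a).
      apply: contrapT => ni; apply: nQ; exists i => // a Qa.
      by apply: contrapT => Qk; apply: ni; exists a.
    apply: (Qprod k _ xpredT a) => [j _|]; first by case: (aP j).
    have ai i : (i < k)%N -> Q i (\prod_j a j).
      by move=> ik; apply: (ideal_prod (i := Ordinal ik)) => //;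
        case: (aP (Ordinal ik)).
    rewrite /Q /ann /= mulrC.
    apply: (kP [set y | y * \prod_j a j = 0]); first exact: ann_ideal.
    by move=> _ [i /= ik <-]; rewrite mulrC; apply: ai.
  exists (k - i)%N; rewrite subn_gt0 ik; apply/asboolP.
  by apply: (QEV _ _ i); rewrite addn0 subnKC; [apply: Qle | apply: ltnW].
have [l /andP[l0 /asboolP Ql] lmin] := ex_minnP perQ.
have Qmod i a : Q i a <-> Q (i %% l)%N a.
  rewrite {1}(divn_eq i l) addnC; elim: (i %/ l)%N => [|q IH];
    first by rewrite addn0.
  rewrite -IH mulSnr addnA -{2}[(_ + q * l)%N]addn0.
  by split=> /(QE _ _ _ Ql).
have Qmodl i j : i = j %[mod l] -> forall a, Q i a -> Q j a.
  by move=> ij a Qa; apply/Qmod; rewrite -ij; apply/(Qmod i a).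
have Qneq i j : (i != j %[mod l])%N -> ~ Q i `<=` Q j.
  have Qlt i' j' : (i' < j' < l)%N -> ~ forall a, Q i' a <-> Q j' a.
    case/andP=> ij jl Qij; have : (l <= j' - i')%N.
      apply: lmin; rewrite subn_gt0 ij; apply/asboolP.
      by apply: (QEV _ _ i'); rewrite addn0 subnKC // ltnW.
    by rewrite leqNgt (leq_ltn_trans (leq_subr _ _) jl).
  move=> ij /Qle Qij.
  have {}Qij a : Q (i %% l)%N a <-> Q (j %% l)%N a by rewrite -!Qmod.
  case: (ltngtP (i %% l)%N (j %% l)%N) ij => // ij _.
    by apply: (Qlt _ _ _ Qij); rewrite ij ltn_pmod.
  by apply: (@Qlt (j %% l)%N (i %% l)%N) => [|a]; rewrite ?ij ?ltn_pmod ?Qij.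
have N0 a : (forall i, Q i a) -> a = 0.
  move=> Qa; apply: (simple_ideal0 s_simple (J := [set a | forall i,
    Q i a])) => //.
  - split=> [i|b u v _ /= Qu Qv i]; first exact: (ideal_zero (Qi i)).
    exact: (ideal_muladd _ (Qi i)).
  - move=> b /= Qb [|i]; last by apply/QS.
    by apply: (@Qmodl l); rewrite ?modnn ?mod0n // -(prednK l0); apply/QS.
  - by move=> /(_ 0%N); apply: Q1.
pose J i : set R := [set a | forall j, (j != i %[mod l])%N -> Q j a].
have Ji i : ideal (J i).
  split=> [j _|b u v _ /= Ju Jv j ij]; first exact: (ideal_zero (Qi j)).
  by apply: (ideal_muladd _ (Qi j)); [apply: Ju | apply: Jv].
have JS i a : J i a -> J i.+1 (s a).
  move=> Ja [|j] ij; last first.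
    by apply/QS/Ja; move: ij; rewrite -(addn1 i) -(addn1 j) eqn_modDr.
  apply: (@Qmodl l); rewrite ?modnn ?mod0n // -(prednK l0); apply/QS/Ja.
  by apply: contra ij; rewrite -(eqn_modDr 1) !addn1 prednK // modnn mod0n.
have J_mod i j a : i = j %[mod l] -> J i a -> J j a.
  by move=> ij Ja k kj; apply: Ja; rewrite ij.
have JJ i j a b : (i != j %[mod l])%N -> J i a -> J j b -> a * b = 0.
  move=> ij Ja Jb; apply: N0 => k.
  have [ki|/Ja Qa] := eqVneq (k %% l)%N (i %% l)%N;
    last exact: (ideal_mulr _ (Qi k)).
  by apply/(ideal_mull _ (Qi k))/Jb; rewrite ki.
(* The summands of [1] in the sum of the [J i] are the wanted idempotents. That sum is nonzero
   because it contains [B], a product of elements of the [Q i], [0 < i < l], taken outside the prime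
   [Q 0]. *)
have [c Jc sum_c] : exists2 c : nat -> R, forall i,
  J i (c i) & \sum_(i < l) c i = 1.
  have /boolp.choice[b bP] (i : 'I_l) :
      exists b, (i != 0%N :> nat) -> Q i b /\ ~ Q 0%N b.
    have [i0|i0] := eqVneq (i : nat) 0%N; first by exists 0.
    apply: contrapT => nb; apply: (@Qneq i 0%N) => [|a Qa].
      by rewrite mod0n modn_small.
    by apply: contrapT => Q0; apply: nb; exists a.
  have Jb : J 0%N (\prod_(i < l | i != 0%N :> nat) b i).
    move=> j; rewrite mod0n => j0; apply/Qmod.
    have jl : (j %% l < l)%N by rewrite ltn_pmod.
    rewrite (bigD1 (Ordinal jl)) //=; apply: (ideal_mulr _ (Qi _)).
    by case: (bP (Ordinal jl)).
  move: Jb; set B := \prod_(i < l | _) _ => Jb.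
  pose T := [set a | exists2 c : nat -> R, forall i,
    J i (c i) & \sum_(i < l) c i = a].
  apply: (simple_ideal1 s_simple (J := T)) (_ : T B) _.
  - split.
      by exists (fun=> 0) => [i|]; [apply: (ideal_zero (Ji i)) | rewrite big1].
    move=> a _ _ _ [u Ju <-] [v Jv <-]; exists (fun i => a * u i + v i).
      by move=> i; apply: (ideal_muladd _ (Ji i)).
    by rewrite big_split mulr_sumr.
  - move=> _ [u Ju <-].
    (* [s] rotates the summands: the last one goes from [J l.-1] to [J l], which is [J 0]. *)
    exists (fun i => s (if i is j.+1 then u j else u l.-1)).
      case=> [|i]; last exact: JS.
      by apply: (@J_mod l); rewrite ?modnn ?mod0n // -{1}(prednK l0); apply: JS.
    rewrite rmorph_sum -(prednK l0) big_ord_recl big_ord_recr /= addrC.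
    by congr (_ + _); apply: eq_bigr.
  - exists (fun i => if (i %% l == 0)%N then B else 0).
      move=> i; case: eqP => [i0|_]; last exact: (ideal_zero (Ji i)).
      by apply: (@J_mod 0%N); rewrite ?i0 ?mod0n.
    rewrite (bigD1 (Ordinal l0)) //= mod0n eqxx big1 ?addr0 // => i i0.
    by rewrite modn_small // ifN.
  - apply/eqP => b0; apply: (@Qprod 0%N _ (fun i : 'I_l => i != 0%N :> nat) b).
      by move=> i /bP[].
    by rewrite -/B b0; apply: (ideal_zero (Qi _)).
have modl i j : (i < l)%N -> (j < l)%N -> (i != j %[mod l])%N = (i != j).
  by move=> il jl; rewrite !modn_small.
have cc i j : (i < l)%N -> (j < l)%N -> i != j -> c i * c j = 0.
  by move=> il jl ij; apply: (JJ i j); rewrite ?modl.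
have cE i a : (i < l)%N -> J i a -> a * c i = a.
  move=> il Ja; rewrite -[RHS]mulr1 -sum_c (bigD1 (Ordinal il)) //=.
  rewrite mulrDr mulr_sumr big1 ?addr0 // => j ji.
  by apply: (JJ i j) => //; rewrite modl // eq_sym.
(* Both sides equal [c j * s (c i)]: [c j] acts as a unit on [J j], and the other [s (c k)] are
   orthogonal to it. *)
have cS i j : (i < l)%N -> (j < l)%N -> i.+1 = j %[mod l] -> s (c i) = c j.
  move=> il jl ij; have Jsc : J j (s (c i)) by apply: (J_mod _ _ _ ij);
    apply: JS.
  rewrite -[LHS](cE j) // mulrC -[RHS]mulr1 -(rmorph1 s) -sum_c rmorph_sum.
  rewrite (bigD1 (Ordinal il)) //= mulrDr mulr_sumr big1 ?addr0 // => k ki.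
  apply: (JJ j k.+1); [|exact: Jc|exact/JS/Jc].
  by rewrite -ij -(addn1 i) -(addn1 k) eqn_modDr modl // eq_sym.
have c_iter i : (i < l)%N -> iter i s (c 0%N) = c i.
  elim: i => // i IH il; rewrite iterS IH 1?ltnW //.
  by apply: cS => //; apply: ltnW.
have c_iterl : iter l s (c 0%N) = c 0%N.
  rewrite -{1}(prednK l0) iterS c_iter ?prednK //; apply: cS;
    rewrite ?prednK //.
  by rewrite modnn mod0n.
have cQ i : (i < l)%N -> ~ Q i (c i).
  move=> il Qc; apply: (Q1 i); rewrite -sum_c; apply: ideal_sum => // j _.
  have [->//|ij] := eqVneq (j : nat) i.
  by apply: Jc; rewrite modl // eq_sym.
have c0 i : (i < l)%N -> c i != 0.
  by move=> il; apply/eqP => ci0; apply: (cQ i il); rewrite ci0;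
    apply: (ideal_zero (Qi i)).
have ccE i : (i < l)%N -> c i * c i = c i by move=> il; apply: cE.
have cdom i a b : (i < l)%N -> (c i * a) * (c i * b) = 0 -> c i * a =
  0 \/ c i * b = 0.
  move=> il ab0.
  (* A multiple of [c i] lies in every [Q j] with [j] not congruent to [i], so it vanishes once it
     lies in the prime [Q i]. *)
  have caN d : Q i (c i * d) -> c i * d = 0.
    move=> Qcd; apply: N0 => j; have [ji|ji] := eqVneq (j %% l)%N (i %% l)%N.
      by apply: (Qmodl i).
    by apply: (ideal_mulr _ (Qi j)); apply: (Jc i).
  by have [|/caN|/caN] := Qprime i (c i * a) (c i * b); [rewrite ab0;
    apply: (ideal_zero (Qi i)) | left | right].
exists l, (DomainIdempotent (ccE _ l0) (c0 _ l0) (fun a b => @cdom _ a b l0)).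
split => //=.
- move=> f; split=> [[ff f0 fmin]|[i il ->]].
    have [i fi] : exists i : 'I_l, f * c i != 0.
      apply: contrapT => nf; case/eqP: f0; rewrite -[f]mulr1 -sum_c mulr_sumr.
      by rewrite big1 // => i _; apply/eqP/negPn/negP => fi; apply: nf;
        exists i.
    exists i => //; rewrite c_iter //.
    have fc : f * c i = f.
      case: (fmin (f * c i)) => // [||fc0].
      - by rewrite mulrACA ff ccE.
      - by rewrite mulrA ff.
      - by rewrite fc0 eqxx in fi.
    have [|cf0|/eqP] := cdom i f (f - 1) (ltn_ord i).
    - by rewrite mulrACA mulrBr ff mulr1 subrr mulr0.
    - by rewrite -fc mulrC cf0 eqxx in f0.
    - by rewrite mulrBr mulr1 subr_eq0 mulrC fc => /eqP.
  rewrite c_iter //; split=> // [||g gg cg]; [exact: ccE | exact: c0 |].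
  have [||/eqP] := cdom i g (c i - g) il.
  + by rewrite mulrBr ccE // cg mulrBr gg mulrC cg subrr.
  + by rewrite cg; left.
  + by rewrite mulrBr ccE // cg subr_eq0 => /eqP->; right.
- by move=> i j il jl ij; rewrite !c_iter //; apply: cc.
- by rewrite -[RHS]sum_c; apply: eq_bigr => i _; rewrite c_iter.
Qed.

End IdempotentDecomposition.

(** * Constants *)

Section Constants.
Variables (R : comNzRingType) (s : {rmorphism R -> R}).

Definition const_pred : {pred R} := fun x => s x == x.

Fact const_pred_subring : GRing.subring_closed const_pred.
Proof.
split=> [|x y|x y]; rewrite !unfold_in ?rmorph1 // => /eqP sx /eqP sy.
  by rewrite rmorphB sx sy.
by rewrite rmorphM sx sy.
Qed.

HB.instance Definition _ :=
  GRing.isSubringClosed.Build R const_pred const_pred_subring.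

(** The proof of simplicity is a parameter of the type so that the field structure, which depends on
    it, can be declared as an instance. *)
Record constants (s_simple : difference_simple s) := Constants {
  const_val : R;
  const_valP : const_val \in const_pred
}.

Variable s_simple : difference_simple s.
Local Notation C := (constants s_simple).

HB.instance Definition _ := [isSub for @const_val s_simple].
HB.instance Definition _ := [Choice of C by <:].
HB.instance Definition _ := [SubChoice_isSubComNzRing of C by <:].

(** The ideal generated by a constant is a difference ideal, so [x] is invertible in [R]; applying
    [s] to the equation of the inverse shows that the inverse is constant. *)
Lemma constants_inv (x : C) : x != 0 -> exists y : C, y * x = 1.
Proof.
move=> x0; have vx0 : val x != 0 by rewrite -(rmorph0 (val : {rmorphism C ->
  R})) (inj_eq val_inj).
have sx : s (val x) = val x by apply/eqP; have := valP x.
have [|y /= | |y yx] := @simple_ideal1 R s s_simple [set y | exists z,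
  y = z * val x] (val x) _ _ _ vx0.
- split; first by exists 0; rewrite mul0r.
  by move=> a _ _ _ [u ->] [v ->]; exists (a * u + v); rewrite mulrDl mulrA.
- by move=> [u ->]; exists (s u); rewrite rmorphM sx.
- by exists 1; rewrite mul1r.
have sy : y \in const_pred.
  rewrite unfold_in; apply/eqP.
  have syx : s y * val x = 1 by rewrite -{1}sx -rmorphM -yx rmorph1.
  by rewrite -[LHS]mulr1 yx mulrCA syx mulr1.
by exists (Constants s_simple sy); apply: val_inj; rewrite /= -yx.
Qed.

Definition const_inv (x : C) : C := xget 0 [set y | x != 0 /\ y * x = 1].

Fact const_mulVf (x : C) : x != 0 -> const_inv x * x = 1.
Proof.
move=> x0; have [y yx] := constants_inv x0.
by have [] := @xgetPex _ 0 [set y | x != 0 /\ y * x =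
  1] (ex_intro _ y (conj x0 yx)).
Qed.

Fact const_inv0 : const_inv 0 = 0.
Proof. by apply: xgetPN => y [/negP]. Qed.

HB.instance Definition _ := GRing.ComNzRing_isField.Build C const_mulVf
  const_inv0.

End Constants.

Lemma constants_field (R : comNzRingType) (s : {rmorphism R -> R}) :
  difference_simple s ->
  exists (C : fieldType) (h : {rmorphism C -> R}),
    forall x, s x = x <-> exists c, h c = x.
Proof.
move=> s_simple; exists (constants s_simple : fieldType), val => x.
split=> [/eqP sx|[c <-]]; first by exists (Constants s_simple sx).
by apply/eqP; have := valP c.
Qed.

(** * Linear algebra over a field mapping to a ring *)

Section LinearAlgebra.
Variables (C : fieldType) (V : comNzRingType) (h : {rmorphism C -> V}).
Implicit Types (D : set V).

Definition lin_free (I : finType) (b : I -> V) : Prop :=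
  forall c : I -> C, \sum_i h (c i) * b i = 0 -> forall i, c i = 0.

Definition lin_span (I : finType) (b : I -> V) : set V :=
  [set x | exists c : I -> C, x = \sum_i h (c i) * b i].

(** [D] is any subset, not only a subspace; with [D] the range of a finite family, this extracts a
    basis from that family. *)
Definition lin_basis (D : set V) (I : finType) (b : I -> V) : Prop :=
  [/\ forall i, D (b i), lin_free b & D `<=` lin_span b].

Lemma lin_free_card (I J : finType) (b : I -> V) (b' : J -> V) :
  lin_free b -> (forall i, lin_span b' (b i)) -> (#|I| <= #|J|)%N.
Proof.
move=> fb /fin_all_exists[M bM].
pose A : 'M[C]_(#|I|, #|J|) := \matrix_(i, j) M (enum_val i) (enum_val j).
rewrite leqNgt; apply/negP => JI.
have /rowV0Pn[v /sub_kermxP vA /eqP] : kermx A != 0.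
  rewrite kermx_eq0 -row_leq_rank -ltnNge; exact: leq_ltn_trans (rank_leq_col
    _) JI.
apply; apply/rowP => i; rewrite mxE.
have := fb (fun i => v 0 (enum_rank i)) _ (enum_val i); rewrite enum_valK;
  apply.
under eq_bigr do rewrite bM mulr_sumr.
rewrite exchange_big big1 // => j _.
transitivity (h 0 * b' j); last by rewrite rmorph0 mul0r.
have := congr1 (fun w : 'rV_ _ => w 0 (enum_rank j)) vA; rewrite !mxE => <-.
rewrite rmorph_sum mulr_suml [RHS](reindex (@enum_rank I)) /=; last first.
  exact/onW_bij/enum_rank_bij.
by apply: eq_bigr => k _; rewrite mxE !enum_rankK rmorphM mulrA.
Qed.

Lemma lin_basis_card D (I J : finType) (b : I -> V) (b' : J -> V) :
  lin_basis D b -> lin_basis D b' -> #|I| = #|J|.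
Proof.
move=> [Db fb Sb] [Db' fb' Sb']; apply/eqP; rewrite eqn_leq.
rewrite (lin_free_card fb (b' := b')) ?(lin_free_card fb' (b' := b)) //.
  by move=> i; apply: Sb.
by move=> i; apply: Sb'.
Qed.

Lemma lin_basis_exists D N :
  (forall k (b : 'I_k -> V), (forall i, D (b i)) -> lin_free b -> (k <= N)%N) ->
  exists k (b : 'I_k -> V), lin_basis D b.
Proof.
move=> bound.
pose P k := `[< exists b : 'I_k -> V, (forall i, D (b i)) /\ lin_free b >].
have exP : exists k, P k.
  by exists 0%N; apply/asboolP; exists (fun=> 0); split=> [[]|c _ []].
have bP k : P k -> (k <= N)%N by move=> /asboolP[b [Db fb]]; apply: bound fb.
have [k /asboolP[b [Db fb]] kmax] := ex_maxnP exP bP.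
exists k, b; split=> // x Dx; apply: contrapT => nx.
have : P k.+1.
  apply/asboolP; exists (fun i => if unlift ord0 i is Some j then b j else x).
  split=> [i|c]; first by case: unliftP.
  rewrite big_ord_recl unlift_none.
  under eq_bigr do rewrite liftK.
  move=> cx; have c0 : c ord0 = 0.
    apply/eqP/negPn/negP => c0; apply: nx.
    exists (fun i => - (c ord0)^-1 * c (lift ord0 i)).
    under eq_bigr do rewrite rmorphM -mulrA.
    rewrite -mulr_sumr; have -> : \sum_i h (c (lift ord0 i)) * b i =
      - (h (c ord0) * x).
      by apply/eqP; rewrite -subr_eq0 opprK addrC cx.
    by rewrite mulrN rmorphN mulNr opprK mulrA -rmorphM mulVf // rmorph1 mul1r.
  move=> i; case: (unliftP ord0 i) => [j|] -> //.
  by move: cx; rewrite c0 rmorph0 mul0r add0r => /fb.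
by move/kmax; rewrite ltnn.
Qed.

Lemma lin_basis_reindex D (I J : finType) (b : I -> V) :
  lin_basis D b -> #|I| = #|J| -> exists b' : J -> V, lin_basis D b'.
Proof.
move=> [Db fb Sb] IJ.
pose f (j : J) : I := enum_val (cast_ord (esym IJ) (enum_rank j)).
pose g (i : I) : J := enum_val (cast_ord IJ (enum_rank i)).
have fK : cancel f g by move=> j; rewrite /f /g enum_valK cast_ordKV enum_rankK.
have gK : cancel g f by move=> i; rewrite /f /g enum_valK cast_ordK enum_rankK.
have f_bij : {on predT, bijective f} by apply: onW_bij; exists g.
exists (b \o f); split=> [j|c sc j|x /Sb[c ->]] /=; first exact: Db.
  rewrite -(fK j); apply: (fb (c \o g)).
  by rewrite (reindex f) // -[RHS]sc; apply: eq_bigr => i _; rewrite /= fK.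
by exists (c \o f); rewrite (reindex f).
Qed.

End LinearAlgebra.

(** * Linear disjointness of constants *)

Section LinearDisjointness.
Variables (R S : comNzRingType) (s : {rmorphism R -> R}) (sS : {rmorphism S ->
  S}).
Variables (j : {rmorphism R -> S}) (C L : fieldType).
Variables (h : {rmorphism C -> R}) (g : {rmorphism L ->
  S}) (m : {rmorphism C -> L}).
Hypothesis s_simple : difference_simple s.
Hypothesis j_equiv : forall x, j (s x) = sS (j x).
Hypothesis hP : forall x, s x = x <-> exists c, h c = x.
Hypothesis gP : forall y, sS y = y <-> exists c, g c = y.
Hypothesis gm : forall c, g (m c) = j (h c).

Let gfix x : sS (g x) = g x. Proof. by apply/gP; exists x. Qed.

(* The coefficients of [d] in the linear relations over [R] between the
   constants [d, b_1, ..., b_n] form a difference ideal of [R]. *)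
Lemma constant_dichotomy n (b : 'I_n -> L) (d : L) :
  (exists r : 'I_n -> R, g d = \sum_i j (r i) * g (b i)) \/
  (forall a (r : 'I_n -> R), j a * g d = \sum_i j (r i) * g (b i) -> a = 0).
Proof.
pose J := [set a | exists r : 'I_n -> R, j a * g d = \sum_i j (r i) * g (b i)].
have iJ : ideal J.
  split.
    exists (fun=> 0); rewrite rmorph0 mul0r big1 // => i _.
    by rewrite mul0r.
  move=> a u v _ [ru ur] [rv vr]; exists (fun i => a * ru i + rv i).
  rewrite rmorphD rmorphM mulrDl -mulrA ur vr mulr_sumr -big_split /=.
  by apply: eq_bigr => i _; rewrite rmorphD rmorphM mulrDl mulrA.
have sJ a : J a -> J (s a).
  move=> [ra ar]; exists (fun i => s (ra i)).
  rewrite j_equiv -(gfix d) -rmorphM ar rmorph_sum.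
  by apply: eq_bigr => i _; rewrite rmorphM j_equiv gfix.
have [[r]|J1] := pselect (J 1).
  by rewrite rmorph1 mul1r => dr; left; exists r.
by right=> a r ar; apply: (simple_ideal0 s_simple iJ sJ J1); exists r.
Qed.

(** If [b ord0] is a combination of the other [b i], it is eliminated. Otherwise, subtracting from
    the relation its image under [sS] leaves [b ord0] with the coefficient [r ord0 - s (r ord0)],
    which must vanish; so [r ord0] is a constant of [R], and that term can be moved to the side of
    [c]. *)
Lemma constant_span n (b : 'I_n -> L) (c : L) (r : 'I_n -> R) :
  g c = \sum_i j (r i) * g (b i) -> lin_span m b c.
Proof.
elim: n b c r => [|n IH] b c r.
  rewrite big_ord0 => gc; exists (fun=> 0); rewrite big_ord0.
  by apply/eqP; rewrite -(fmorph_eq0 g) gc.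
pose b' i := b (lift ord0 i).
have extend x c' : lin_span m b' c' -> lin_span m b (m x * b ord0 + c').
  case=> d ->; exists (fun i => if unlift ord0 i is Some k then d k else x).
  by rewrite big_ord_recl unlift_none; under [in RHS]eq_bigr do rewrite liftK.
rewrite big_ord_recl => gc.
have [[r1 b0r]|b0r] := constant_dichotomy b' (b ord0).
  rewrite -[c]add0r -(mul0r (b ord0)) -(rmorph0 m); apply: extend.
  apply: (IH _ _ (fun i => r ord0 * r1 i + r (lift ord0 i))).
  rewrite gc b0r mulr_sumr -big_split /=.
  by apply: eq_bigr => i _; rewrite rmorphD rmorphM mulrDl mulrA.
have /hP[x xr] : s (r ord0) = r ord0.
  apply/eqP; rewrite -subr_eq0; apply/eqP.
  apply: (b0r _ (fun i => r (lift ord0 i) - s (r (lift ord0 i)))).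
  rewrite rmorphB mulrBl; apply/eqP; rewrite subr_eq.
  under eq_bigr do rewrite rmorphB mulrBl.
  rewrite sumrB addrAC eq_sym subr_eq eq_sym.
  rewrite [X in X == _]addrC [X in _ == X]addrC -gc.
  rewrite -[g c]gfix gc rmorphD rmorphM rmorph_sum j_equiv gfix; apply/eqP.
  rewrite addrC; congr (_ + _); apply: eq_bigr => i _.
  by rewrite rmorphM j_equiv gfix.
rewrite -(subrK (m x * b ord0) c) addrC; apply: extend.
apply: (IH _ _ (fun i => r (lift ord0 i))).
by rewrite rmorphB rmorphM gm xr gc addrAC subrr add0r.
Qed.

(** By the dichotomy, either the coefficient of [b ord0] vanishes, or [b ord0] is a combination of
    the other [b i] over [R], hence over [C] by [constant_span], against freeness. *)
Lemma constant_free n (b : 'I_n -> L) (r : 'I_n -> R) :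
  lin_free m b -> \sum_i j (r i) * g (b i) = 0 -> forall i, r i = 0.
Proof.
elim: n b r => [|n IH] b r fb; first by move=> _ [].
pose b' i := b (lift ord0 i).
rewrite big_ord_recl => r0.
have fb' : lin_free m b'.
  move=> c c0 i.
  have := fb (fun i => if unlift ord0 i is Some k then c k else 0) _ (lift ord0
    i).
  rewrite liftK; apply; rewrite big_ord_recl unlift_none rmorph0 mul0r add0r.
  by under eq_bigr do rewrite liftK.
have rE : r ord0 = 0.
  have [[r1 /constant_span[c b0]]|b0] := constant_dichotomy b' (b ord0).
    have := fb (fun i => if unlift ord0 i is Some k then - c k else 1) _ ord0.
    rewrite unlift_none big_ord_recl unlift_none rmorph1 mul1r.
    under eq_bigr do rewrite liftK rmorphN mulNr.
    by rewrite sumrN b0 subrr => /(_ erefl)/eqP; rewrite oner_eq0.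
  apply: (b0 _ (fun i => - r (lift ord0 i))).
  under eq_bigr do rewrite rmorphN mulNr.
  by apply/eqP; rewrite sumrN -subr_eq0 opprK r0.
move=> i; case: (unliftP ord0 i) => [k|] -> //.
by apply: (IH b' (fun i => r (lift ord0 i))); rewrite // -[RHS]r0 rE rmorph0
  mul0r add0r.
Qed.

(** Expanding the coefficients over a [C]-basis [b] of their span turns a relation over [L] into one
    between the [b l] over [R]; by [constant_free] its coefficients vanish, and these are relations
    over [C] between the [x i]. *)
Lemma lin_free_extension (I : finType) (x : I -> R) :
  lin_free h x -> lin_free g (j \o x).
Proof.
move=> fx c c0 i.
have [|k [b [_ fb Sb]]] := @lin_basis_exists _ _ m (range c) #|I|.
  move=> n b cb /lin_free_card; rewrite card_ord; apply => k.
  have [i' _ <-] := cb k; exists (fun l => (l == i')%:R).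
  rewrite (bigD1 i') //= eqxx rmorph1 mul1r big1 ?addr0 // => l /negPf->.
  by rewrite rmorph0 mul0r.
have /fin_all_exists[M cM] l : exists d : 'I_k -> C, c l = \sum_i m (d i) * b i.
  by apply: Sb; exists l.
have M0 l : \sum_i h (M i l) * x i = 0.
  move: l; apply: (constant_free (r := fun l => \sum_i h (M i l) * x i) fb).
  rewrite -[RHS]c0; under [RHS]eq_bigr do rewrite cM rmorph_sum mulr_suml.
  rewrite [RHS]exchange_big; apply: eq_bigr => l' _.
  rewrite rmorph_sum mulr_suml; apply: eq_bigr => i' _.
  by rewrite !rmorphM gm /= mulrAC.
rewrite cM big1 // => l _.
by rewrite (fx (M^~ l)) // rmorph0 mul0r.
Qed.

End LinearDisjointness.

(** * Zariski's lemma *)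

Lemma lead_coef_integral (D S : comNzRingType) (h : {rmorphism D -> S})
    (P : {poly D}) (x : S) :
  root (map_poly h P) x -> P != 0 -> integralOver h (h (lead_coef P) * x).
Proof.
move=> Px P0; set c := lead_coef P; pose n := (size P).-1.
have Pn : size P = n.+1 by rewrite prednK // size_poly_gt0.
have cE : P`_n = c by [].
(* Degree 0 can occur, because [h] may kill the constant [P]. In positive degree, [c^(n-1) * P(x)]
   is the value at [c * x] of the monic polynomial [Q] below. *)
have [n0|n0] := posnP n.
  have Pc : h c = 0.
    move/eqP: Px; rewrite (@horner_coef_wide _ n.+1) -?Pn ?size_poly //.
    by rewrite Pn n0 big_ord_recl big_ord0 coef_map expr0 mulr1 addr0 /c
      lead_coefE -/n n0.
  by rewrite Pc mul0r; apply: integral0.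
pose Q := \poly_(i < n.+1) if i == n then 1 else P`_i * c ^+ (n.-1 - i).
have Qn : Q`_n = 1 by rewrite coef_poly ltnSn eqxx.
have Qs : size Q = n.+1 by rewrite size_poly_eq // eqxx oner_neq0.
exists Q; first by rewrite monicE lead_coefE Qs Qn.
rewrite rootE (@horner_coef_wide _ n.+1) -?Qs ?size_poly //.
rewrite Qs.
have : h c ^+ n.-1 * (map_poly h P).[x] = 0 by rewrite (eqP Px) mulr0.
rewrite (@horner_coef_wide _ n.+1) -?Pn ?size_poly // Pn => Px'.
rewrite -[X in _ == X]Px' mulr_sumr; apply/eqP; apply: eq_bigr => i _.
rewrite !coef_map /= coef_poly ltn_ord exprMn; case: eqP => [-> | /eqP ni].
  by rewrite rmorph1 mul1r cE -{1}(prednK n0) exprSr -mulrA.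
have ilt : (i <= n.-1)%N by rewrite -ltnS prednK // ltn_neqAle ni -ltnS ltn_ord.
rewrite rmorphM rmorphXn /= -[in RHS](subnK ilt) exprD.
by rewrite -mulrA [RHS]mulrCA !mulrA.
Qed.

Section IntegralSubring.
Variables (D S : comNzRingType) (h : {rmorphism D -> S}).

Lemma integral_generated (l : seq S) :
  (forall T : {pred S}, GRing.subring_closed T -> (forall a, h a \in T) ->
     {subset l <= T} -> forall x, x \in T) ->
  (forall x, x \in l -> integralOver h x) -> forall x, integralOver h x.
Proof.
move=> gen int_l x; apply/(asbool_predE [set x | integralOver h x]); apply: gen.
- split; first by apply/asbool_predE; apply: integral1.
    by move=> u v /asbool_predE hu /asbool_predE hv;
      apply/asbool_predE/integral_sub.
  by move=> u v /asbool_predE hu /asbool_predE hv;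
    apply/asbool_predE/integral_mul.
- by move=> a; apply/asbool_predE/integral_id.
- by move=> y /int_l hy; apply/asbool_predE.
Qed.

End IntegralSubring.

(* A domain [D] such that some localization [D_f] has [L] as an integral
   extension has [D_f] as a field; this is impossible for [D = D'[X]], where
   [1 + f X] is not invertible in [D_f], so no generator is transcendental. *)
Lemma field_generated_over_domain (D : idomainType) (L : fieldType)
    (h : {rmorphism D -> L}) (l : seq L) :
  injective h ->
  (forall T : {pred L}, GRing.subring_closed T -> (forall a, h a \in T) ->
     {subset l <= T} -> forall x, x \in T) ->
  exists2 f, f != 0 & forall x, exists N, integralOver h (h (f ^+ N) * x).
Proof.
have [n] := ubnP (size l); elim: n D h l => // n IH D h l ln h_inj gen.
have [alg_l|] := pselect (forall t, t \in l ->
    exists2 P : {poly D}, P != 0 & root (map_poly h P) t).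
  have [f [f0 fl]] : exists f, f != 0 /\ forall t,
    t \in l -> integralOver h (h f * t).
    elim: l alg_l {ln gen} => [|t l IHl] alg_l.
      by exists 1; split; first exact: oner_neq0.
    have [|f [f0 fl]] := IHl; first by move=> u ul; apply: alg_l;
      rewrite inE ul orbT.
    have [P P0 Pt] := alg_l t (mem_head _ _).
    exists (f * lead_coef P); split; first by rewrite mulf_neq0 ?lead_coef_eq0.
    move=> u; rewrite inE => /predU1P[->|/fl fu]; rewrite rmorphM.
      rewrite -mulrA; apply: integral_mul; first exact: integral_id.
      exact: lead_coef_integral.
    rewrite -mulrA mulrCA; apply: integral_mul => //; exact: integral_id.
  exists f => // x.
  apply/(asbool_predE [set x | exists N, integralOver h (h (f ^+ N) * x)]);
    apply: gen.
  - split; first by apply/asbool_predE; exists 0%N; rewrite mulr1;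
    apply: integral_id.
      move=> u v /asbool_predE[N uN] /asbool_predE[M vM]; apply/asbool_predE.
      exists (N + M)%N; rewrite exprD rmorphM mulrBr; apply: integral_sub.
        by rewrite -mulrA mulrCA; apply: integral_mul => //; apply: integral_id.
      by rewrite -mulrA; apply: integral_mul => //; apply: integral_id.
    move=> u v /asbool_predE[N uN] /asbool_predE[M vM]; apply/asbool_predE.
    by exists (N + M)%N; rewrite exprD rmorphM mulrACA; apply: integral_mul.
  - move=> a; apply/asbool_predE; exists 0%N; rewrite expr0 rmorph1 mul1r.
    exact: integral_id.
  - by move=> t tl; apply/asbool_predE; exists 1%N; rewrite expr1; apply: fl.
move=> nalg; exfalso.
have [t tl tP] : exists2 t, t \in l & forall P : {poly D},
  root (map_poly h P) t -> P = 0.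
  apply: contrapT => nt; apply: nalg => t tl; apply: contrapT => nP.
  apply: nt; exists t => // P Pt; apply/eqP/negPn/negP => P0; apply: nP.
  by exists P.
have [ev [evE evC evX]] : exists ev : {rmorphism {poly D} -> L},
    [/\ forall P, ev P = (map_poly h P).[t], forall a,
      ev a%:P = h a & ev 'X = t].
  exists (horner_morph (fun x => mulrC t (h x))); split=> //.
    exact: horner_morphC.
  exact: horner_morphX.
have ev_inj : injective ev.
  by apply: raddf_inj => P evP; apply: tP; rewrite rootE -evE evP.
have [|||f f0 fN] := IH _ ev (rem t l).
- by rewrite size_rem //; move: ln; case: (l) tl.
- exact: ev_inj.
- move=> T Tsub Th Tl x; apply: gen => // [a|u].
    by rewrite -evC.
  rewrite (perm_mem (perm_to_rem tl)) inE => /predU1P[->|/Tl//].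
  by rewrite -evX.
pose q : {poly D} := f * 'X + 1%:P.
have q_size : size q = (size f).+1 by rewrite size_MXaddC (negPf f0).
have q0 : q != 0 by rewrite -size_poly_gt0 q_size.
have evq0 : ev q != 0 by rewrite -(rmorph0 ev) (inj_eq ev_inj).
have [N [p p_monic /eqP pu]] := fN (ev q)^-1.
pose d := (size p).-1.
have pd : size p = d.+1 by rewrite prednK // size_poly_gt0 monic_neq0.
pose w := \sum_(i < d) p`_i * f ^+ (N * i) * q ^+ (d.-1 - i).
(* The monic equation of [f^N / q], multiplied by [q^d]. *)
have fq : f ^+ (N * d) = - (q * w).
  apply: ev_inj; apply/eqP; rewrite -subr_eq0 rmorphN opprK.
  move: pu; rewrite (@horner_coef_wide _ d.+1) -?pd ?size_poly // pd.
  move/(congr1 (fun x => ev q ^+ d * x)); rewrite mulr0 mulr_sumr big_ord_recr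
    /=.
  have pd1 : p`_d = 1 by rewrite -[RHS](monicP p_monic) lead_coefE.
  rewrite coef_map /= pd1.
  rewrite rmorph1 mul1r exprMn exprVn mulrCA divff ?expf_neq0 // mulr1.
  rewrite -!rmorphXn -exprM => pu0; apply/eqP; rewrite -[RHS]pu0 addrC;
    congr (_ + _).
  rewrite rmorphM rmorph_sum mulr_sumr; apply: eq_bigr => i _.
  rewrite coef_map /= !rmorphM !rmorphXn exprMn -exprM exprVn.
  have -> : ev q ^+ d = ev q * ev q ^+ (d.-1 - i) * ev q ^+ i.
    by rewrite -exprS -exprD; case: (d) i => [[]//|d'] i /=;
      rewrite addSn subnK // -ltnS.
  rewrite [ev p`_i * (_ / _)]mulrA [RHS]mulrACA divff ?expf_neq0 // mulr1.
  by rewrite -[RHS]mulrA [ev q ^+ _ * _]mulrC.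
(* Modulo [q], [f * 'X] is [-1], so its power of exponent [M] is invertible; but [f^M] is a multiple
   of [q]. Hence [q] is a unit of the polynomial ring, which its degree forbids. *)
have [v qv] : exists v, q * v = 1.
  pose M := (N * d)%N.
  have := subrXX (q - 1) (-1) M.
  rewrite opprK subrK => /(canRL (subrK _)).
  have -> : q - 1 = f * 'X by rewrite /q addrK.
  rewrite exprMn fq; set B := \sum_(i < M) _ => e.
  exists ((-1) ^+ M * (- w * 'X^M - B)).
  rewrite mulrCA mulrBr mulrA mulrN e addrAC subrr add0r -exprD addnn.
  by rewrite -mul2n exprM sqrrN expr1n expr1n.
have v0 : v != 0 by apply: contra_eq_neq qv => ->;
  rewrite mulr0 eq_sym oner_neq0.
have := size_mul q0 v0; rewrite qv size_poly1 q_size.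
have : (0 < size f)%N by rewrite size_poly_gt0.
have : (0 < size v)%N by rewrite size_poly_gt0.
by case: (size v) (size f) => [|a] [|b] //=; rewrite addnS.
Qed.

Lemma zariski (k L : fieldType) (h : {rmorphism k -> L}) (l : seq L) :
  (forall T : {pred L}, GRing.subring_closed T -> (forall a, h a \in T) ->
     {subset l <= T} -> forall x, x \in T) ->
  forall x, integralOver h x.
Proof.
move=> gen x.
have [f f0 fN] := field_generated_over_domain (fmorph_inj h) gen.
have [N fx] := fN x.
rewrite -[x](mulKf (expf_neq0 N _ : h f ^+ N != 0)) ?fmorph_eq0 //.
rewrite -rmorphXn -fmorphV; apply: integral_mul => //; exact: integral_id.
Qed.

(** * Krull dimension and integral extensions *)

Section IntegralExtension.
Variables (A B : comNzRingType) (j : {rmorphism A -> B}).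
Hypothesis (j_inj : injective j) (j_int : forall b, integralOver j b).

Lemma add_principal_ideal (J : set B) (u : B) :
  ideal J -> ideal [set x | exists2 b, J (x - u * b) & True].
Proof.
move=> iJ; split.
  by exists 0; rewrite // mulr0 subr0; apply: ideal_zero iJ.
move=> a x y _ [bx Jx _] [by_ Jy _]; exists (a * bx + by_) => //.
rewrite mulrDr opprD addrACA mulrCA -mulrBr.
exact: ideal_muladd iJ Jx Jy.
Qed.

(** An ideal maximal among those containing [I] and avoiding the image of the complement of [P] is
    prime. Taking [I = [set 0]] starts a chain of primes, and taking for [I] the last prime of a
    chain prolongs it. *)
Lemma lying_over (P : {pred A}) (I : set B) :
  prime_ideal P -> ideal I -> (forall a, I (j a) -> a \in P) ->
  exists Q : {pred B}, [/\ prime_ideal Q, forall x, I x -> x \in Q &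
    forall a, (j a \in Q) = (a \in P)].
Proof.
move=> [iP' pP] iI IP; have [_ P1 _] := iP'; have iP := idealr_ideal iP'.
pose M := [set x | exists2 a, a \notin P & x = j a].
have IM : I `&` M `<=` set0.
  by move=> x [Ix [a /negP aP xa]]; apply/aP/IP; rewrite -xa.
have [//|J [iJ _ JM IJ Jmax]] := @maximal_submodule _ setT id M I iI _ IM.
have J_meets u : ~ J u -> exists b s, [/\ s \notin P & J (j s - u * b)].
  move=> nJu; apply: contrapT => nM; apply: nJu.
  apply: (Jmax _ (add_principal_ideal u iJ)) => //.
  - move=> x [[b Jx _] [s sP xs]]; apply: nM; exists b, s; rewrite -xs;
    split=> //.
  - by move=> x Jx; exists 0; rewrite // mulr0 subr0.
  - by exists 1; rewrite // mulr1 subrr; apply: ideal_zero iJ.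
have JP a : J (j a) -> a \in P.
  by move=> Ja; apply/negPn/negP => aP; apply: (JM (j a)); split=> //; exists a.
have J1 : ~ J 1 by rewrite -(rmorph1 j) => /JP; apply/negP.
have Jprime u v : J (u * v) -> J u \/ J v.
  move=> Juv; apply: contrapT => /not_orP[/J_meets[b [s [sP us]]] /J_meets[c [t
    [tP vt]]]].
  have : s * t \in P.
    apply: JP; rewrite rmorphM.
    have -> : j s * j t = (j s - u * b) * j t + u * b * (j t - v * c) + (u * v)
      * (b * c).
      by ring.
    apply: (ideal_add iJ); last exact: ideal_mulr iJ Juv.
    by apply: (ideal_add iJ); [apply: ideal_mulr iJ us | apply: ideal_mull iJ
      vt].
  by move/pP/orP => []; apply/negP.
exists (asbool_pred J); split.
- split; first exact: idealrP.
  by move=> u v /asbool_predE/Jprime[] /asbool_predE ->; rewrite ?orbT.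
- by move=> x /IJ Jx; apply/asbool_predE.
- move=> a; apply/idP/idP => [/asbool_predE/JP//|aP]; apply/asbool_predE.
  apply: contrapT => /J_meets[b [s [sP Js]]].
  (* Modulo [J], [j s] is [j a * b]. The equation of [b] multiplied by [a^n] thus becomes a monic
     one for [s], valid modulo [P], whose lower coefficients are multiples of [a]. As [a] is in [P],
     so is [s^n]. *)
  have [p p_monic /eqP pb] := j_int b.
  pose n := (size p).-1.
  have pn : size p = n.+1 by rewrite prednK // size_poly_gt0 monic_neq0.
  have pn1 : p`_n = 1 by rewrite -[RHS](monicP p_monic) lead_coefE.
  have Jexp i : J (j s ^+ i - (j a * b) ^+ i).
    by rewrite subrXX; apply: ideal_mulr iJ Js.
  have /JP : J (j (\sum_(i < n.+1) p`_i * a ^+ (n - i) * s ^+ i)).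
    have pb0 : \sum_(i < n.+1) j (p`_i * a ^+ (n - i)) * (j a * b) ^+ i = 0.
      transitivity (j a ^+ n * (map_poly j p).[b]); last by rewrite pb mulr0.
      rewrite (@horner_coef_wide _ n.+1) -?pn ?size_poly // pn mulr_sumr.
      apply: eq_bigr => i _; rewrite coef_map /= rmorphM rmorphXn /= exprMn.
      rewrite -[X in _ = _ ^+ X * _](subnK (_ : i <= n)%N);
        last by rewrite -ltnS.
      by rewrite exprD; ring.
    rewrite -[j _]subr0 -[in X in _ - X]pb0 rmorph_sum -sumrB.
    apply: ideal_sum => // i _; rewrite rmorphM rmorphXn /= -mulrBr.
    exact: ideal_mull iJ (Jexp i).
  rewrite big_ord_recr /= pn1 mul1r subnn expr0 mul1r => Psum.
  have sn : s ^+ n \in P.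
    rewrite -[s ^+ n](addrK (\sum_(i < n) p`_i * a ^+ (n - i) * s ^+ i)) addrC.
    rewrite addrC [_ + \sum_(i < n) _]addrC.
    apply: (ideal_sub iP) => //; apply: ideal_sum => // i _.
    apply: (ideal_mulr _ iP); apply: (ideal_mull _ iP).
    by rewrite -(subnSK (ltn_ord i)) exprS; apply: (ideal_mulr _ iP).
  elim: n {pn pn1 Psum} sn => [|n IHn]; first by rewrite expr0 (negPf P1).
  by rewrite exprS => /pP/orP[|/IHn//]; rewrite (negPf sP).
Qed.

(** Take a monic [p] with [p(b)] in [Q]. Its constant term [c] is in [Q'] since [b] is; if it is
    also in [Q], primality allows a factor [b] to be cancelled and the degree drops. This must stop,
    as [1] is not in [Q]. *)
Lemma incomparability (Q : {pred B}) (Q' : set B) (b : B) :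
  prime_ideal Q -> ideal Q' -> (forall x, x \in Q -> Q' x) -> Q' b ->
    b \notin Q ->
  exists2 a, Q' (j a) & j a \notin Q.
Proof.
move=> [iQ pQ] iQ' QQ' Q'b bQ; have [Q0 Q1 _] := iQ.
have [p p_monic pb] := j_int b.
have {pb} : (map_poly j p).[b] \in Q by rewrite (eqP pb).
have [n] := ubnP (size p); elim: n p p_monic => // n IH p p_monic pn pQb.
have [q [c pE]] : exists q c, p = q * 'X + c%:P by elim/poly_ind: (p) => [|q c
  _]; [exists 0, 0; rewrite mul0r add0r | exists q, c].
have pbE : (map_poly j p).[b] = (map_poly j q).[b] * b + j c.
  by rewrite pE rmorphD rmorphM /= map_polyX map_polyC /= !hornerE.
have Q'c : Q' (j c).
  rewrite -[j c](addKr ((map_poly j q).[b] * b)) -pbE addrC.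
  by apply: (ideal_sub iQ'); [apply: QQ' | apply: (ideal_mull _ iQ')].
have [cQ|cQ] := boolP (j c \in Q); last by exists c.
have q0 : q != 0.
  apply/eqP => q0; move: p_monic pQb; rewrite pE q0 mul0r add0r monicE
    lead_coefC.
  by move=> /eqP ->; rewrite map_polyC /= rmorph1 hornerC (negPf Q1).
have ps : size p = (size q).+1 by rewrite pE size_MXaddC (negPf q0).
apply: (IH q).
- rewrite monicE lead_coefE -(monicP p_monic) lead_coefE ps pE /=.
  by rewrite coefD coefMX coefC -(prednK (_ : 0 < size q)%N) ?size_poly_gt0 //=
    addr0.
- by move: pn; rewrite ps.
- have : (map_poly j q).[b] * b \in Q.
    rewrite -[X in X \in _](addrK (j c)) -pbE.
    exact: (ideal_sub (idealr_ideal iQ)).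
  by move/pQ/orP => [//|]; rewrite (negPf bQ).
Qed.

Lemma prime_chain_lift d (P : nat -> {pred A}) : prime_chain d P ->
  exists2 Q : nat -> {pred B}, prime_chain d Q &
    forall a, (j a \in Q d) = (a \in P d).
Proof.
elim: d => [|d IH] [pP sP].
  have [||Q [pQ _ QP]] := @lying_over (P 0%N) [set 0] (pP _ (leqnn _)).
  - by split=> // a u v _ /= -> ->; rewrite mulr0 addr0.
  - move=> a /= /eqP; rewrite -(rmorph0 j) (inj_eq j_inj) => /eqP->.
    by have [[]] := pP _ (leqnn 0).
  by exists (fun=> Q) => //; split.
have [|Q [pQ sQ] QP] := IH.
  split=> i id; first exact/pP/leqW.
  exact/sP/leqW.
have iQd : ideal [set x | x \in Q d] by apply: idealr_ideal;
  have [] := pQ _ (leqnn d).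
have [|Q' [pQ' QQ' Q'P]] := lying_over (pP _ (leqnn d.+1)) iQd.
  by move=> a /=; rewrite QP; have [sPd _] := sP _ (leqnn _); apply: sPd.
exists (fun i => if (i <= d)%N then Q i else Q'); last by rewrite ltnn.
split=> i id; first by case: ifP => [/pQ|].
move: id; rewrite ltnS => id; rewrite id.
move: id; rewrite leq_eqVlt => /predU1P[->|id].
  rewrite ltnn; split=> [x|]; first exact: QQ'.
  have [_ [x xP xnP]] := sP _ (leqnn d.+1).
  by exists (j x); rewrite ?Q'P ?QP.
by rewrite id; apply: sQ.
Qed.

Lemma prime_chain_contract d (Q : nat -> {pred B}) : prime_chain d Q ->
  exists P : nat -> {pred A}, prime_chain d P.
Proof.
move=> [pQ sQ]; exists (fun i a => j a \in Q i); split=> i id.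
  have [[Q0 Q1 QD] QM] := pQ i id; split; first split.
  - by rewrite unfold_in rmorph0.
  - by rewrite unfold_in rmorph1.
  - by move=> a u v; rewrite !unfold_in rmorphD rmorphM; apply: QD.
  - by move=> u v; rewrite !unfold_in rmorphM; apply: QM.
have [QQ [x xQ xnQ]] := sQ i id; split=> [a|]; first by rewrite !unfold_in;
  apply: QQ.
have [iQ _] := pQ i.+1 id.
have [a Qa nQa] := incomparability (pQ i (ltnW id)) (idealr_ideal iQ) QQ xQ xnQ.
by exists a.
Qed.

Lemma krull_dim_integral : krull_dim A = krull_dim B.
Proof.
rewrite /krull_dim; congr (xget None [set Some d | d in _]).
have chainE d : (exists P : nat -> {pred A}, prime_chain d P) <->
                (exists Q : nat -> {pred B}, prime_chain d Q).
  split=> [[P /prime_chain_lift[Q Qd _]]|[Q /prime_chain_contract//]].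
  by exists Q.
apply/seteqP; split=> d /= [/chainE dP dmax]; split=> // d' P dP'.
  by have [|Q /dmax] := (chainE d').2; first by exists P.
by have [|Q /dmax] := (chainE d').1; first by exists P.
Qed.

End IntegralExtension.

(** * Quotients *)

Lemma quotient_exists (T : comNzRingType) (J : set T) : ideal J -> ~ J 1 ->
  exists (S : comNzRingType) (p : {rmorphism T -> S}),
    (forall y, exists x, p x = y) /\ (forall x, p x = 0 <-> J x).
Proof.
move=> iJ J1.
pose I : idealr T := HB.pack (asbool_pred J) (isIdealr.Build T _ (idealrP iJ
  J1)).
pose S : comNzRingType := {ideal_quot I}.
pose p : T -> S := \pi_{ideal_quot I}%qT.
have pB : zmod_morphism p by move=> x y; rewrite /p !piE.
have pM : monoid_morphism p by split=> [|x y]; rewrite /p !piE.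
pose p' : {rmorphism T -> S} := HB.pack p
  (GRing.isZmodMorphism.Build T S p pB) (GRing.isMonoidMorphism.Build T S p pM).
exists S, p'; split=> [y|x]; first by exists (repr y); rewrite /= /p reprK.
split=> [px|/asbool_predE Jx].
  apply/asbool_predE; rewrite -[x]subr0.
  have /eqP : p x = p 0 by rewrite [LHS]px -[RHS]/(p' 0) rmorph0.
  by rewrite /p -Quotient.idealrBE.
have : x - 0 \in I by rewrite subr0.
by rewrite Quotient.idealrBE => /eqP e; rewrite -[RHS](rmorph0 p') /= /p.
Qed.

Lemma factor_surjection (T S U : comNzRingType)
    (p : {rmorphism T -> S}) (f : {rmorphism T -> U}) :
  (forall y, exists x, p x = y) -> (forall x, p x = 0 -> f x = 0) ->
  exists g : {rmorphism S -> U}, forall x, g (p x) = f x.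
Proof.
move=> /boolp.choice[q qK] pf.
pose g y := f (q y).
have gE x : g (p x) = f x.
  by apply/eqP; rewrite -subr_eq0 -rmorphB pf // rmorphB qK subrr.
have gB : zmod_morphism g.
  by move=> x y; rewrite -[x]qK -[y]qK -rmorphB !gE rmorphB.
have gM : monoid_morphism g.
  split=> [|x y]; first by rewrite -(rmorph1 p) gE rmorph1.
  by rewrite -[x]qK -[y]qK -rmorphM !gE rmorphM.
pose g' : {rmorphism S -> U} := HB.pack g
  (GRing.isZmodMorphism.Build S U g gB) (GRing.isMonoidMorphism.Build S U g gM).
by exists g'.
Qed.

Lemma simple_quotient (T : comNzRingType) (s : {rmorphism T -> T}) (I : set T) :
  ideal I -> (forall x, I x -> I (s x)) -> ~ I 1 ->
  exists (S : comNzRingType) (sS : {rmorphism S -> S}) (p : {rmorphism T -> S}),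
    [/\ difference_simple sS, forall x, p (s x) = sS (p x),
        forall y, exists x, p x = y & forall x, I x -> p x = 0].
Proof.
move=> iI sI I1.
have [//|J [iJ sJ JM IJ Jmax]] := @maximal_submodule _ setT s [set 1] I iI sI _.
  by move=> x [Ix x1]; apply: I1; rewrite -x1.
have J1 : ~ J 1 by move=> J1; apply: (JM 1).
have [S [p [p_surj pJ]]] := quotient_exists iJ J1.
have [x px|sS sSp] := factor_surjection (f := p \o s) p_surj _.
  by apply/pJ/sJ/pJ.
exists S, sS, p; split=> // [I' iI' sI' y|x /IJ/pJ//].

have [I'0 I'1 _] := iI'.
apply/idP/idP => [yI'|]; last by rewrite inE => /eqP->.
have [x pxy] := p_surj y; rewrite inE -pxy; apply/eqP/pJ.
apply: (Jmax (p @^-1` [set z | z \in I'])).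
- exact/preimage_ideal/idealr_ideal.
- by move=> z /= pz; have /= <- := sSp z; apply: sI'.
- by move=> z [/= zI' z1]; move: zI'; rewrite z1 rmorph1 (negPf I'1).
- by move=> z /pJ /= ->.
- by rewrite /= pxy.
Qed.

(** A [K]-subspace [W] maximal among those avoiding [1] is a complement of the line of [1], and
    [phi] is the projection along [W]. *)
Lemma linear_retraction (K : fieldType) (R : comNzRingType) (iota : {rmorphism
  K -> R}) :
  exists phi : R -> K, [/\ zmod_morphism phi, phi 1 = 1 &
    forall a x, phi (iota a * x) = a * phi x].
Proof.
have [|||W [sW _ W1 _ Wmax]] := @maximal_submodule _ (range iota) id [set 1]
  [set 0].
- by split=> // a u v _ /= -> ->; rewrite mulr0 addr0.
- by [].
- by move=> x [/= -> /eqP]; rewrite eq_sym oner_eq0.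
have WDM a u v : W u -> W v -> W (iota a * u + v).
  by case: sW => _ + Wu Wv; apply=> //; exists a.
have W0 : W 0 by case: sW.
have WM a u : W u -> W (iota a * u) by move=> Wu; rewrite -[_ * _]addr0;
  apply: WDM.
have nW1 : ~ W 1 by move=> ?; apply: (W1 1).
have [x|phi phiP] := @boolp.choice R K (fun x a => W (x - iota a)).
  have [Wx|nWx] := pselect (W x); first by exists 0; rewrite rmorph0 subr0.
  (* Otherwise [W] plus the line of [x] would still avoid [1]. *)
  have [a Wa] : exists a, W (1 - iota a * x).
    apply: contrapT => na; apply: nWx.
    apply: (Wmax [set y | exists a, W (y - iota a * x)]) => //.
    + split; first by exists 0; rewrite rmorph0 mul0r subr0.
      move=> _ u v [c _ <-] [a ua] [b vb]; exists (c * a + b).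
      rewrite rmorphD rmorphM.
      have -> : iota c * u + v - (iota c * iota a + iota b) * x =
                iota c * (u - iota a * x) + (v - iota b * x) by ring.
      exact: WDM.
    + by move=> y [[a ya] /= y1]; apply: na; exists a; rewrite -y1.
    + by move=> y Wy; exists 0; rewrite rmorph0 mul0r subr0.
    + by exists 1; rewrite rmorph1 mul1r subrr.
  have a0 : a != 0 by apply: contra_notN nW1 => /eqP a0; move: Wa;
    rewrite a0 rmorph0 mul0r subr0.
  exists a^-1; have -> : x - iota a^-1 = iota (- a^-1) * (1 - iota a * x).
    rewrite rmorphN mulrBr mulr1 !mulNr mulrA -rmorphM mulVf // rmorph1 mul1r.
    by rewrite opprK addrC.
  exact: WM.
have phi_uniq x a : W (x - iota a) -> phi x = a.
  move=> Wx; apply/eqP; rewrite -subr_eq0; apply: contrapT => /negP c0.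
  apply: nW1; have : W (iota (phi x - a)).
    rewrite rmorphB; have -> : iota (phi x) - iota a =
      iota (-1) * (x - iota (phi x)) + (x - iota a).
      by rewrite rmorphN1; ring.
    exact: WDM.
  by move/(WM (phi x - a)^-1); rewrite -rmorphM mulVf // rmorph1.
exists phi; split.
- move=> x y; apply: phi_uniq; rewrite rmorphB.
  have -> : x - y - (iota (phi x) - iota (phi y)) =
      iota (-1) * (y - iota (phi y)) + (x - iota (phi x)) by rewrite rmorphN1;
        ring.
  exact: WDM.
- by apply: phi_uniq; rewrite rmorph1 subrr.
- by move=> a x; apply: phi_uniq; rewrite rmorphM -mulrBr; apply: WM.
Qed.

(** * Tensor products of difference rings *)

(* The monoid algebras of the library require that only the unit be invertible
   in the monoid; so we adjoin a new unit to the multiplicative monoid of [R]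
   and identify it with [1] in [tensor_rel] below. *)
Definition adjoin_unit (R : comNzRingType) : Type := option R.

HB.instance Definition _ (R : comNzRingType) := Choice.on (adjoin_unit R).

Section AdjoinUnit.
Variable R : comNzRingType.

Definition adjoin_unit_mul (x y : adjoin_unit R) : adjoin_unit R :=
  match x, y with
  | Some a, Some b => Some (a * b)
  | Some a, None => x
  | None, _ => y
  end.

Fact adjoin_unit_mulA : associative adjoin_unit_mul.
Proof. by move=> [a|] [b|] [c|] //=; rewrite mulrA. Qed.
Fact adjoin_unit_mulC : commutative adjoin_unit_mul.
Proof. by move=> [a|] [b|] //=; rewrite mulrC. Qed.
Fact adjoin_unit_mul1 : left_id None adjoin_unit_mul.
Proof. by []. Qed.
Fact adjoin_unit_mulr1 : right_id None adjoin_unit_mul.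
Proof. by case. Qed.
Fact adjoin_unit_unit x y : adjoin_unit_mul x y = None -> x = None /\ y = None.
Proof. by case: x y => [a|] [b|]. Qed.

HB.instance Definition _ := Choice_isMonomialDef.Build (adjoin_unit R)
  adjoin_unit_mulA adjoin_unit_mul1 adjoin_unit_mulr1 adjoin_unit_unit.
HB.instance Definition _ := MonomialDef_isConomialDef.Build (adjoin_unit R)
  adjoin_unit_mulC.

Definition adjoin_unit_eval (S : comNzRingType) (f : R ->
  S) (x : adjoin_unit R) : S :=
  if x is Some a then f a else 1.

Lemma adjoin_unit_eval_mmorphism (S : comNzRingType) (f : R -> S) :
  {morph f : x y / x * y} -> monalg.mmorphism (adjoin_unit_eval f).
Proof. by move=> fM; split=> // -[a|] [b|] //=; rewrite ?mul1r ?mulr1 ?fM. Qed.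

End AdjoinUnit.

Section Tensor.
Variables (K : fieldType) (R1 R2 : comNzRingType).
Variables (iota1 : {rmorphism K -> R1}) (iota2 : {rmorphism K -> R2}).

Local Notation M := (adjoin_unit R2).
Local Notation P := {malg R1[M]}.
Local Notation U x := (<< (Some x : M) >> : P).

(** The monoid algebra already respects products of elements of [R2]; what remains to impose is the
    unit, additivity, and the agreement of both images of [K]. *)
Definition tensor_rel : set P :=
  [set p | [\/ p = U 1 - 1, exists x y, p = U (x - y) - (U x - U y) |
               exists a, p = U (iota2 a) - malgC (iota1 a)]].

Lemma malg_unitM (c1 c2 : R1) (m1 m2 : M) :
  << c1 *g m1 >> * << c2 *g m2 >> = << c1 * c2 *g (monalg.mul m1 m2) >> :> P.
Proof. by rewrite malgM_def fgmulUU. Qed.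

(* With a [K]-linear retraction [phi] of [R1] onto [K], the map
   [r (x) x |-> phi r * x] shows that the tensor product is not zero. *)
Lemma tensor_proper : ~ gen_ideal tensor_rel 1.
Proof.
have [phi [phiB phi1 phiM]] := linear_retraction iota1.
pose f : {additive R1 -> R2} := HB.pack (iota2 \o phi)
  (GRing.isZmodMorphism.Build R1 R2 (iota2 \o phi) (fun x y =>
     etrans (congr1 iota2 (phiB x y)) (rmorphB iota2 _ _))).
pose ev : M -> R2 := adjoin_unit_eval id.
have evM m1 m2 : ev (monalg.mul m1 m2) = ev m1 * ev m2.
  by have [] := @adjoin_unit_eval_mmorphism R2 R2 id (fun _ _ => erefl).
pose psi : {additive P -> R2} := mmap f ev.
have psiU c m : psi << c *g m >> = f c * ev m by apply: mmapU.
(* [psi] is only additive, so its kernel is replaced by the largest ideal inside it. *)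
pose J : set P := [set p | forall q, psi (q * p) = 0].
have iJ : ideal J.
  split=> [q|a u v _ Ju Jv q]; first by rewrite mulr0 raddf0.
  by rewrite mulrDr raddfD mulrA Ju Jv addr0.
have JP p : (forall c m, psi (<< c *g m >> * p) = 0) -> J p.
  move=> pP q; rewrite (monalgE q) mulr_suml raddf_sum big1 // => k _;
    exact: pP.
suff GJ : tensor_rel `<=` J.
  move=> /(gen_ideal_min iJ GJ)/(_ 1); rewrite mulr1 -[1]/(<< 1 *g monalg.one
    >>) psiU /=.
  by rewrite mulr1 phi1 rmorph1 => /eqP; rewrite oner_eq0.
move=> p [->|[x [y ->]]|[a ->]]; apply: JP => c m.
- by rewrite mulrBr mulr1 raddfB malg_unitM !psiU evM /= !mulr1 subrr.
- by rewrite !mulrBr !raddfB !malg_unitM !psiU !evM /= !mulr1; ring.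
- rewrite mulrBr raddfB !malg_unitM !psiU !evM /= !mulr1 (mulrC c) phiM rmorphM.
  by ring.
Qed.

Variables (s1 : {rmorphism R1 -> R1}) (s2 : {rmorphism R2 -> R2}).
Variable sK : {rmorphism K -> K}.
Hypothesis iota1_s : forall a, s1 (iota1 a) = iota1 (sK a).
Hypothesis iota2_s : forall a, s2 (iota2 a) = iota2 (sK a).

Lemma simple_compositum :
  exists (S : comNzRingType) (sS : {rmorphism S -> S})
    (j1 : {rmorphism R1 -> S}) (j2 : {rmorphism R2 -> S}),
    [/\ difference_simple sS,
        (forall x, j1 (s1 x) = sS (j1 x)) /\ (forall x, j2 (s2 x) = sS (j2 x)),
        forall a, j1 (iota1 a) = j2 (iota2 a) &
        forall T : {pred S}, GRing.subring_closed T ->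
          (forall x, j1 x \in T) -> (forall x, j2 x \in T) -> forall x,
            x \in T].
Proof.
pose h (m : M) : P := adjoin_unit_eval (fun x => U (s2 x)) m.
have hM : monalg.mmorphism h.
  by apply: adjoin_unit_eval_mmorphism => x y; rewrite malg_unitM mulr1 rmorphM.
pose h' : {mmorphism M -> P} := HB.pack h (monalg.isMultiplicative.Build M P h
  hM).
pose f : {rmorphism R1 -> P} := (malgC : {rmorphism R1 -> P}) \o s1.
pose sP : {rmorphism P -> P} := mmap f h'.
have sPU c m : sP << c *g m >> = malgC (s1 c) * h m by apply: mmapU.
pose I := gen_ideal tensor_rel.
have iI : ideal I := gen_ideal_ideal _.
have sPU1 x : sP (U x) = U (s2 x) by rewrite sPU rmorph1 mul1r.
have sPC c : sP (malgC c) = malgC (s1 c) by rewrite sPU mulr1.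
have sI p : I p -> I (sP p).
  apply: (@gen_ideal_min _ _ (sP @^-1` I)); first exact: preimage_ideal.
  move=> {}p [->|[x [y ->]]|[a ->]]; apply: sub_gen_ideal.
  - by constructor 1; rewrite rmorphB rmorph1 sPU1 rmorph1.
  - by constructor 2; exists (s2 x), (s2 y); rewrite !rmorphB !sPU1 rmorphB.
  - by constructor 3; exists (sK a); rewrite rmorphB sPU1 sPC iota1_s iota2_s.
have [S [sS [p [sS_simple ps p_surj pI]]]] := simple_quotient iI sI
  tensor_proper.
have pU1 : p (U 1) = 1.
  apply/eqP; rewrite -subr_eq0 -(rmorph1 p) -rmorphB; apply/eqP; apply: pI;
    apply: sub_gen_ideal.
  by constructor 1.
have j2B : zmod_morphism (fun x => p (U x)).
  move=> x y; apply/eqP; rewrite -subr_eq0 -!rmorphB; apply/eqP; apply: pI;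
    apply: sub_gen_ideal.
  by constructor 2; exists x, y.
have j2M : monoid_morphism (fun x => p (U x)).
  by split=> // x y; rewrite -rmorphM malg_unitM mulr1.
pose j2 : {rmorphism R2 -> S} := HB.pack (fun x => p (U x))
  (GRing.isZmodMorphism.Build _ _ _ j2B) (GRing.isMonoidMorphism.Build _ _ _
    j2M).
pose j1 : {rmorphism R1 -> S} := p \o (malgC : {rmorphism R1 -> P}).
exists S, sS, j1, j2; split=> //.
- by split=> x; rewrite /= -ps ?sPC ?sPU1.
- move=> a; apply/esym/eqP; rewrite -subr_eq0 /= -rmorphB; apply/eqP;
  apply: pI; apply: sub_gen_ideal.
  by constructor 3; exists a.
move=> T T_sub T1 T2 y.
pose T' : subringClosed S := HB.pack T (GRing.isSubringClosed.Build S T T_sub).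
have [q <-] := p_surj y; change (p q \in T').
rewrite (monalgE q) rmorph_sum; apply: rpred_sum => m _.
rewrite -[q@_m]mulr1 -[m]mul1m -malg_unitM rmorphM.
apply: rpredM; first exact: T1.
by case: m => [x|]; [apply: T2 | rewrite (rmorph1 p); apply: rpred1].
Qed.

End Tensor.

(** * Extension of constants *)

Section LinearDimension.
Variables (C : fieldType) (V : comNzRingType) (h : {rmorphism C -> V}).

Definition lin_dim (D : set V) : option nat :=
  xget None [set Some k | k in [set k | exists b : 'I_k -> V, lin_basis h D b]].

Lemma lin_dimE (D : set V) k (b : 'I_k -> V) : lin_basis h D b -> lin_dim D =
  Some k.
Proof.
move=> Db; rewrite /lin_dim; case: xgetP => [_ -> [k' [b' Db'] <-]|].
  by rewrite -(card_ord k') (lin_basis_card Db' Db) card_ord.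
by move=> /(_ (Some k)); case; exists k => //; exists b.
Qed.

End LinearDimension.

Lemma rmorph_iter (R S : comNzRingType) (f : {rmorphism R -> S})
    (s : {rmorphism R -> R}) (t : {rmorphism S -> S}) n x :
  (forall x, f (s x) = t (f x)) -> f (iter n s x) = iter n t (f x).
Proof. by move=> fs; elim: n => //= n <-. Qed.

Section ExtensionOfConstants.
Variables (R S : comNzRingType) (s : {rmorphism R -> R}) (sS : {rmorphism S ->
  S}).
Variables (j : {rmorphism R -> S}) (C L : fieldType).
Variables (h : {rmorphism C -> R}) (g : {rmorphism L -> S}).
Hypothesis s_simple : difference_simple s.
Hypothesis j_equiv : forall x, j (s x) = sS (j x).
Hypothesis hP : forall x, s x = x <-> exists c, h c = x.
Hypothesis gP : forall y, sS y = y <-> exists c, g c = y.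
Variable l : seq S.
Hypothesis l_const : forall z, z \in l -> sS z = z.
Hypothesis l_gen : forall T : {pred S}, GRing.subring_closed T ->
  (forall x, j x \in T) -> {subset l <= T} -> forall x, x \in T.

Lemma constants_morphism : exists m : {rmorphism C -> L}, forall c,
  g (m c) = j (h c).
Proof.
have [c|m gm] := @boolp.choice C L (fun c x => g x = j (h c)).
  by apply/gP; rewrite -j_equiv; congr (j _); apply/hP; exists c.
have mB : zmod_morphism m.
  by move=> x y; apply: (fmorph_inj g); rewrite rmorphB !gm !rmorphB.
have mM : monoid_morphism m.
  split=> [|x y]; apply: (fmorph_inj g); first by rewrite gm !rmorph1.
  by rewrite rmorphM !gm !rmorphM.
pose m' : {rmorphism C -> L} := HB.pack m
  (GRing.isZmodMorphism.Build _ _ _ mB) (GRing.isMonoidMorphism.Build _ _ _ mM).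
by exists m'.
Qed.

(** The subring [T] makes it possible to deduce that [L] is generated over [C] by the given
    constants: by [constant_span], a constant that is an [R]-combination of elements of [T] is a
    [C]-combination of them. *)
Lemma spanned_by_constants (T : {pred L}) : GRing.subring_closed T ->
  (forall c, g c \in l -> c \in T) ->
  forall x, exists n (b : 'I_n -> L) (r : 'I_n -> R),
    (forall i, b i \in T) /\ x = \sum_i j (r i) * g (b i).
Proof.
move=> T_sub lT x; have [T1 TB TM] := T_sub.
have TN u : u \in T -> - u \in T.
  move=> Tu; rewrite -sub0r; apply: (TB) => //.
  by rewrite -(subrr 1); apply: TB.
pose comb (q : seq (R * L)) := \sum_(p <- q) j p.1 * g p.2.
have [q qT ->] : exists2 q : seq (R * L), all (fun p => p.2 \in T) q & x =
  comb q.
  pose W := [set x | exists2 q : seq (R * L), all (fun p => p.2 \in T) q & x =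
    comb q].
  apply/(asbool_predE W); apply: l_gen; first split.
  - by apply/asbool_predE; exists [:: (1, 1)];
    rewrite /= ?T1 // /comb big_seq1 !rmorph1 mulr1.
  - move=> u v /asbool_predE[q qT ->] /asbool_predE[q' qT' ->];
    apply/asbool_predE.
    exists (q ++ [seq (p.1, - p.2) | p <- q']).
      rewrite all_cat qT all_map; apply/allP => p /(allP qT') /=; exact: TN.
    rewrite /comb big_cat big_map -sumrN; congr (_ + _).
    by apply: eq_bigr => p _; rewrite /= rmorphN mulrN.
  - move=> u v /asbool_predE[q qT ->] /asbool_predE[q' qT' ->];
    apply/asbool_predE.
    exists [seq (p.1 * p'.1, p.2 * p'.2) | p <- q, p' <- q'].
      by apply/allP => _ /allpairsP[[p p'] [/(allP qT) pT /(allP qT') pT' ->]]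
        /=; apply: TM.
    rewrite /comb big_allpairs_dep mulr_suml; apply: eq_bigr => p _.
    by rewrite mulr_sumr; apply: eq_bigr => p' _; rewrite /= !rmorphM mulrACA.
  - move=> r; apply/asbool_predE; exists [:: (r, 1)]; rewrite /= ?T1 //.
    by rewrite /comb big_seq1 rmorph1 mulr1.
  - move=> z zl; have [c gc] := (gP z).1 (l_const zl); apply/asbool_predE.
    exists [:: (1, c)]; last by rewrite /comb big_seq1 rmorph1 mul1r gc.
    by rewrite /= andbT; apply: lT; rewrite gc.
exists (size q), (fun i => (q`_i).2), (fun i => (q`_i).1); split.
  by move=> i; apply: (allP qT (nth 0 q i)); rewrite mem_nth.
by rewrite /comb (big_nth 0) big_mkord.
Qed.

Lemma extension_of_constants_integral x : integralOver j x.
Proof.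
have [m gm] := constants_morphism.
have /boolp.choice[t tP] z : exists c, z \in l -> g c = z.
  have [zl|] := boolP (z \in l); last by exists 0.
  by have [c gc] := (gP z).1 (l_const zl); exists c.
have L_int : forall c, integralOver m c.
  apply: (@zariski _ _ _ [seq t z | z <- l]) => T T_sub Tm Tl c.
  have [|n [b [r [bT gc]]]] := spanned_by_constants T_sub _ (g c).
    move=> d gd; have -> : d = t (g d) by apply: (fmorph_inj g); rewrite tP.
    by apply/Tl/map_f.
  have [d ->] := constant_span s_simple j_equiv hP gP gm gc.
  pose T' : subringClosed L := HB.pack T (GRing.isSubringClosed.Build L T
    T_sub).
  change (\sum_i m (d i) * b i \in T').
  by apply: rpred_sum => i _; apply: rpredM; [apply: Tm | apply: bT].
apply: (integral_generated l_gen) => z /l_const/gP[c <-].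
have [p p_monic pc] := L_int c.
exists (map_poly h p); first exact: monic_map.
have -> : map_poly j (map_poly h p) = map_poly g (map_poly m p).
  by apply/polyP => i; rewrite !coef_map /= gm.
by rewrite rmorph_root.
Qed.

(** Write a periodic [x] with coefficients in [R] on constants free over [C]. Powers of [sS] fix the
    constants and act on the coefficients alone, so by [constant_free] the coefficients have the
    period of [x]. *)
Lemma periodic_basis_extension k (b : 'I_k -> R) :
  lin_basis h (periodic_elements s) b -> lin_basis g (periodic_elements sS) (j
    \o b).
Proof.
move=> [bD fb Sb]; have [m gm] := constants_morphism.
split=> [i||x [M M0 xM]].
- have [M M0 bM] := bD i; exists M => //=.
  by rewrite -(rmorph_iter _ _ j_equiv) bM.
- exact (lin_free_extension s_simple j_equiv hP gP gm fb).
have [//|//|n [b1 [r [_ xE]]]] := @spanned_by_constants predT _ _ x.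
have [|k' [b' [_ fb' Sb']]] := @lin_basis_exists _ _ m (range b1) n.
  move=> n' b'' cb /lin_free_card => /(_ 'I_n b1); rewrite !card_ord;
    apply => i.
  have [i' _ <-] := cb i; exists (fun i => (i == i')%:R).
  rewrite (bigD1 i') //= eqxx rmorph1 mul1r big1 ?addr0 // => i1 /negPf->.
  by rewrite rmorph0 mul0r.
have /fin_all_exists[N bN] i : exists d : 'I_k' -> C,
  b1 i = \sum_i m (d i) * b' i.
  by apply: Sb'; exists i.
pose r' i := \sum_i1 r i1 * h (N i1 i).
have {}xE : x = \sum_i j (r' i) * g (b' i).
  rewrite xE; under eq_bigr do rewrite bN rmorph_sum mulr_sumr.
  rewrite exchange_big; apply: eq_bigr => i _; rewrite rmorph_sum mulr_suml.
  by apply: eq_bigr => i1 _; rewrite !rmorphM gm /= mulrA.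
have rD i : periodic_elements s (r' i).
  exists M => //; apply/eqP; rewrite -subr_eq0; apply/eqP.
  move: i; apply: (constant_free s_simple j_equiv hP gP gm fb').
  transitivity (iter M sS x - x); last by rewrite xM subrr.
  rewrite xE.
  have -> : iter M sS (\sum_i j (r' i) * g (b' i)) =
    \sum_i j (iter M s (r' i)) * g (b' i).
    elim: (M) => //= M' ->; rewrite rmorph_sum; apply: eq_bigr => i _.
    by rewrite rmorphM j_equiv; congr (_ * _); apply/gP; exists (b' i).
  by rewrite -sumrB; apply: eq_bigr => i _; rewrite rmorphB mulrBl.
have /fin_all_exists[d rd] i := Sb _ (rD i).
exists (fun i => \sum_i1 m (d i1 i) * b' i1).
rewrite xE; under eq_bigr do rewrite rd rmorph_sum mulr_suml.
rewrite exchange_big; apply: eq_bigr => i _; rewrite rmorph_sum mulr_suml.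
by apply: eq_bigr => i1 _; rewrite !rmorphM gm /= mulrAC.
Qed.

(** A finite basis for [S] bounds the free families of periodic elements of [R], which remain free
    over [L]; so the two dimensions are also infinite together. *)
Lemma lin_dim_extension :
  lin_dim h (periodic_elements s) = lin_dim g (periodic_elements sS).
Proof.
have [[k [b Sb]]|nS] :=
    pselect (exists k (b : 'I_k -> S), lin_basis g (periodic_elements sS) b);
      last first.
  rewrite /lin_dim xgetPN; last first.
    move=> _ [k [b Rb] _]; apply: nS; exists k, (j \o b).
    exact: periodic_basis_extension.
  by rewrite xgetPN // => _ [k [b Sb] _]; apply: nS; exists k, b.
have [m gm] := constants_morphism.
have [|k' [b' Rb']] := @lin_basis_exists _ _ h (periodic_elements s) k.
  move=> k' b' Db' fb'.
  have fjb' := lin_free_extension s_simple j_equiv hP gP gm fb'.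
  have [_ _ Db] := Sb.
  rewrite -(card_ord k') -(card_ord k); apply: (lin_free_card fjb' (b' := b))
    => i.
  apply: Db; have [M M0 bM] := Db' i; exists M => //=.
  by rewrite -(rmorph_iter _ _ j_equiv) bM.
by rewrite (lin_dimE Rb') (lin_dimE (periodic_basis_extension Rb')).
Qed.

End ExtensionOfConstants.

(** The constants are the entries of [Z], the quotient of the two fundamental matrices, together
    with the quotient [w] of their determinants. [w] is listed because a subring need not contain
    the inverse of the determinant of [Z]. *)
Lemma pv_constant_generators (K : fieldType) (sK : {rmorphism K -> K})
    (n : nat) (A : 'M[K]_n) (A_unit : A \in unitmx)
    (R1 R2 S : comNzRingType)
    (iota1 : {rmorphism K -> R1}) (iota2 : {rmorphism K -> R2})
    (s1 : {rmorphism R1 -> R1}) (s2 : {rmorphism R2 -> R2})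
    (sS : {rmorphism S -> S})
    (j1 : {rmorphism R1 -> S}) (j2 : {rmorphism R2 -> S}) :
  picard_vessiot sK A iota1 s1 -> picard_vessiot sK A iota2 s2 ->
  (forall x, j1 (s1 x) = sS (j1 x)) -> (forall x, j2 (s2 x) = sS (j2 x)) ->
  (forall a, j1 (iota1 a) = j2 (iota2 a)) ->
  (forall T : {pred S}, GRing.subring_closed T ->
     (forall x, j1 x \in T) -> (forall x, j2 x \in T) -> forall x, x \in T) ->
  exists2 l : seq S, forall z, z \in l -> sS z = z &
    forall T : {pred S}, GRing.subring_closed T ->
      (forall x, j1 x \in T) -> {subset l <= T} -> forall x, x \in T.
Proof.
move=> [_ ext1 [y1 [d1 [yd1 sy1 _]]] _] [_ ext2 [y2 [d2 [yd2 sy2 gen2]]] _].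
move=> j1s j2s j12 genS.
pose Y1 := map_mx j1 y1; pose Y2 := map_mx j2 y2.
pose AS := map_mx (j1 \o iota1) A; pose B := map_mx j1 (d1 *: \adj y1).
have sY1 : map_mx sS Y1 = AS *m Y1.
  have := congr1 (map_mx j1) sy1; rewrite map_mxM -!map_mx_comp => <-.
  by apply/matrixP => i i'; rewrite !mxE /= j1s.
have sY2 : map_mx sS Y2 = AS *m Y2.
  have := congr1 (map_mx j2) sy2; rewrite map_mxM -!map_mx_comp.
  have -> : map_mx (j2 \o iota2) A = AS by apply/matrixP => i i';
    rewrite !mxE /= j12.
  by move=> <-; apply/matrixP => i i'; rewrite !mxE /= j2s.
have BY1 : B *m Y1 = 1%:M.
  by rewrite /B /Y1 -map_mxM -scalemxAl mul_adj_mx -mul_scalar_mx -scalar_mxM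
    mulrC yd1 map_mx1.
have Y1B : Y1 *m B = 1%:M.
  by rewrite /B /Y1 -map_mxM -scalemxAr mul_mx_adj -mul_scalar_mx -scalar_mxM
    mulrC yd1 map_mx1.
pose Z := B *m Y2.
have sZ : map_mx sS Z = Z.
  have sYZ : AS *m (Y1 *m map_mx sS Z) = AS *m Y2.
    by rewrite mulmxA -sY1 -map_mxM /Z mulmxA Y1B mul1mx sY2.
  have ASU : map_mx (j1 \o iota1) (invmx A) *m AS = 1%:M.
    by rewrite /AS -map_mxM mulVmx // map_mx1.
  have /(congr1 (mulmx B)) : Y1 *m map_mx sS Z = Y2.
    by rewrite -[LHS]mul1mx -[RHS]mul1mx -ASU -!mulmxA sYZ.
  by rewrite mulmxA BY1 mul1mx.
pose a := j1 (iota1 (\det A)).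
have sdet1 : sS (j1 (\det y1)) = a * j1 (\det y1).
  by rewrite -!det_map_mx -/Y1 sY1 det_mulmx /AS det_map_mx.
have sdet2 : sS (j2 (\det y2)) = a * j2 (\det y2).
  by rewrite -!det_map_mx -/Y2 sY2 det_mulmx /AS det_map_mx.
have sd2 : a * sS (j2 d2) = j2 d2.
  have e : j2 (\det y2) * j2 d2 = 1 by rewrite -rmorphM yd2 rmorph1.
  have /(congr1 (fun x => j2 d2 * x)) : sS (j2 (\det y2)) * sS (j2 d2) = 1.
    by rewrite -rmorphM e rmorph1.
  rewrite mulr1 sdet2 => {2}<-; rewrite -[LHS]mul1r -e; ring.
pose w := j1 (\det y1) * j2 d2.
have sw : sS w = w.
  by rewrite /w rmorphM sdet1 -[in RHS]sd2; ring.
exists (w :: [seq Z i i' | i <- enum 'I_n, i' <- enum 'I_n]).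
  move=> z; rewrite inE => /predU1P[->//|/allpairsP[[i i'] /= [_ _ ->]]].
  by have := congr1 (fun X : 'M_n => X i i') sZ; rewrite mxE.
move=> T T_sub T1 Tl; apply: genS => // x.
pose T' : subringClosed S := HB.pack T (GRing.isSubringClosed.Build S T T_sub).
have TZ i i' : Z i i' \in T'.
  by apply: Tl; rewrite inE allpairs_f ?orbT // mem_enum.
apply: (gen2 (fun x => j2 x \in T')).
- split=> [|u v uT vT|u v uT vT].
  + by change (j2 1 \in T'); rewrite rmorph1; apply: rpred1.
  + by change (j2 (u - v) \in T'); rewrite rmorphB; apply: rpredB.
  + by change (j2 (u * v) \in T'); rewrite rmorphM; apply: rpredM.
- by move=> b; change (j2 (iota2 b) \in T); rewrite -j12; apply: T1.
- move=> i i'; change (j2 (y2 i i') \in T').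
  have -> : j2 (y2 i i') = (Y1 *m Z) i i' by rewrite /Z mulmxA Y1B mul1mx mxE.
  rewrite mxE; apply: rpred_sum => k _; apply: rpredM; last exact: TZ.
  by rewrite mxE; apply: T1.
- change (j2 d2 \in T'); have -> : j2 d2 = j1 d1 * w.
    by rewrite /w mulrA -rmorphM [d1 * _]mulrC yd1 rmorph1 mul1r.
  by apply: rpredM; [apply: T1 | apply: Tl; rewrite inE eqxx].
Qed.

(** * The m-invariant *)

Section FractionMap.
Variables (D1 D2 : idomainType) (f : {rmorphism D1 -> D2}).
Hypothesis f_inj : injective f.
Local Notation "x %:F" := (@FracField.tofrac _ x).

Lemma fraction_quotient (D : idomainType) (x : {fraction D}) :
  exists a b : D, b != 0 /\ x = a%:F / b%:F.
Proof.
pose r := repr x; have r0 : \d_r != 0 by apply: denom_ratioP.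
exists \n_r, \d_r; split=> //; apply/(canRL (mulfK _));
  first by rewrite tofrac_eq0.
rewrite -[x]reprK -/r; unlock FracField.tofrac.
rewrite -[LHS]FracField.pi_mul; apply/eqP; rewrite FracField.equivf_def.
by rewrite /FracField.mulf !numden_Ratio ?mulf_neq0 ?oner_neq0 // !mulr1 mulrC.
Qed.

Lemma frac_map_tofrac a : frac_map f a%:F = (f a)%:F.
Proof.
have := frac_mapE a f_inj (oner_neq0 D1).
by rewrite !rmorph1 !divr1.
Qed.

Lemma frac_map_zmod_morphism : zmod_morphism (frac_map f).
Proof.
have f0 a : a != 0 -> (f a)%:F != 0.
  by move=> a0; rewrite tofrac_eq0 -(rmorph0 f) (inj_eq f_inj).
move=> x y; have [a [b [b0 ->]]] := fraction_quotient x.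
have [c [d [d0 ->]]] := fraction_quotient y.
have -> : a%:F / b%:F - c%:F / d%:F = (a * d - c * b)%:F / (b * d)%:F.
  by rewrite -mulNr addf_div ?tofrac_eq0 // rmorphB !rmorphM mulNr.
rewrite !frac_mapE ?mulf_neq0 // -[- (_ / _)]mulNr addf_div ?f0 //.
by rewrite !(rmorphB, rmorphM) mulNr.
Qed.

Lemma frac_map_monoid_morphism : monoid_morphism (frac_map f).
Proof.
split=> [|x y]; first by rewrite -(rmorph1 (@FracField.tofrac D1))
  frac_map_tofrac !rmorph1.
have [a [b [b0 ->]]] := fraction_quotient x.
have [c [d [d0 ->]]] := fraction_quotient y.
have -> : a%:F / b%:F * (c%:F / d%:F) = (a * c)%:F / (b * d)%:F.
  by rewrite mulf_div !rmorphM.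
by rewrite !frac_mapE ?mulf_neq0 // mulf_div !rmorphM.
Qed.

End FractionMap.

(** * Periodic elements of a component and of its field of fractions *)

Section Component.
Variables (R : comNzRingType) (e : domain_idempotent R).
Local Notation "x %:F" := (@FracField.tofrac _ x).

Fact proj_zmod_morphism : zmod_morphism (proj e).
Proof.
move=> x y; apply: val_inj; set d := idem_val e.
transitivity (d * (d * x + d * - (d * y))); last by [].
have dd : d * d = d := idem_valM e.
by rewrite val_proj -/d !mulrDr !mulrN !mulrA !dd.
Qed.
Fact proj_monoid_morphism : monoid_morphism (proj e).
Proof.
split=> // x y; apply: val_inj; set d := idem_val e.
transitivity (d * (d * x * (d * y))); last by [].
have dd : d * d = d := idem_valM e.
by rewrite val_proj -/d -!mulrA (mulrCA x d) !mulrA !dd.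
Qed.
HB.instance Definition _ := GRing.isZmodMorphism.Build R (component e) (proj e)
  proj_zmod_morphism.
HB.instance Definition _ := GRing.isMonoidMorphism.Build R (component e) (proj
  e)
  proj_monoid_morphism.

Lemma proj_val (x : component e) : proj e (val x) = x.
Proof. by apply: val_inj; rewrite val_proj compE. Qed.

Lemma val_projK (x : R) : idem_val e * x = x -> val (proj e x) = x.
Proof. by rewrite val_proj. Qed.

Lemma val_comp_eq0 (x : component e) : (val x == 0) = (x == 0).
Proof.
apply/eqP/eqP => [x0|->]; first by rewrite -[x]proj_val x0 rmorph0.
by rewrite -(rmorph0 (proj e)) val_proj mulr0.
Qed.

Variable s : {rmorphism R -> R}.
Variable l : nat.
Hypothesis s_inj : injective s.
Hypothesis dec : idempotent_decomposition s l e.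
Local Notation F := {fraction component e}.

Let iterM n x y : iter n s (x * y) = iter n s x * iter n s y.
Proof. by elim: n => //= n ->; rewrite rmorphM. Qed.
Let iterB n x y : iter n s (x - y) = iter n s x - iter n s y.
Proof. by elim: n => //= n ->; rewrite rmorphB. Qed.
Let iter0 n : iter n s 0 = 0.
Proof. by elim: n => //= n ->; rewrite rmorph0. Qed.
Let iter_inj n : injective (iter n s).
Proof. by elim: n => [//|n IH] x y /= /s_inj/IH. Qed.
Let iter_e q : iter (l * q) s (idem_val e) = idem_val e.
Proof.
elim: q => [|q IH]; first by rewrite muln0.
by rewrite mulnS iterD IH (decomp_stable dec).
Qed.

Lemma idem_ortho i : ~~ (l %| i)%N -> idem_val e * iter i s (idem_val e) = 0.
Proof.
move=> li; have l0 := decomp_gt0 dec.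
rewrite (divn_eq i l) addnC iterD mulnC iter_e.
apply: (decomp_ortho dec (i := 0%N)) => //; first exact: ltn_pmod.
by rewrite eq_sym.
Qed.

Definition comp_shift (x : component e) : component e := proj e (iter l s (val
  x)).

Lemma val_comp_shift x : val (comp_shift x) = iter l s (val x).
Proof. by apply: val_projK; rewrite -{1}(decomp_stable dec) -iterM compE. Qed.

Lemma val_iter_comp_shift n x : val (iter n comp_shift x) =
  iter (l * n) s (val x).
Proof.
elim: n => [|n IH]; first by rewrite muln0.
by rewrite iterS val_comp_shift IH mulnS iterD.
Qed.

Fact comp_shift_zmod_morphism : zmod_morphism comp_shift.
Proof.
move=> x y; apply: val_inj; rewrite val_comp_shift.
rewrite -{1}(proj_val x) -{1}(proj_val y) -rmorphB val_proj iterM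
  (decomp_stable dec) iterB.
by rewrite -!val_comp_shift -[in RHS](proj_val (comp_shift x)) -[in
  RHS](proj_val (comp_shift y)) -rmorphB val_proj.
Qed.
Fact comp_shift_monoid_morphism : monoid_morphism comp_shift.
Proof.
split=> [|x y]; apply: val_inj; rewrite val_comp_shift.
  by rewrite -(rmorph1 (proj e)) val_proj mulr1 (decomp_stable dec).
rewrite -{1}(proj_val x) -{1}(proj_val y) -rmorphM val_proj !iterM
  (decomp_stable dec).
by rewrite -!val_comp_shift -[in RHS](proj_val (comp_shift x)) -[in
  RHS](proj_val (comp_shift y)) -rmorphM val_proj.
Qed.

Let shift : {rmorphism component e -> component e} := HB.pack comp_shift
  (GRing.isZmodMorphism.Build _ _ _ comp_shift_zmod_morphism)
  (GRing.isMonoidMorphism.Build _ _ _ comp_shift_monoid_morphism).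

Let shift_inj : injective shift.
Proof.
move=> x y sxy; apply/val_inj/(@iter_inj l).
by rewrite -!val_comp_shift; exact: congr1 sxy.
Qed.

Local Notation sl := (component_frac_map s l (e := e)).
Let sigma : {rmorphism F -> F} := HB.pack sl
  (GRing.isZmodMorphism.Build F F sl (frac_map_zmod_morphism shift_inj))
  (GRing.isMonoidMorphism.Build F F sl (frac_map_monoid_morphism shift_inj)).

Lemma component_frac_map_iter n x : iter n sl x%:F = (iter n comp_shift x)%:F.
Proof.
elim: n => //= n ->; exact: (frac_map_tofrac shift_inj).
Qed.

Let iter_sigmaM n x y : iter n sl (x * y) = iter n sl x * iter n sl y.
Proof. by elim: n => //= n ->; apply: (rmorphM sigma). Qed.

Hypothesis s_simple : difference_simple s.

(* A difference-simple domain remains simple for the powers of its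
   endomorphism; here, the norm [\prod_(u < n) tau^u a] of [a] generates an
   ideal of [R] all of whose shifts are in the given ideal on [eR]. *)
Lemma component_simple n (I : set (component e)) a : (0 < n)%N -> ideal I ->
  (forall x, I x -> I (iter n comp_shift x)) -> I a -> a != 0 -> I 1.
Proof.
move=> n0 iI sI Ia a0.
have shift_iter0 u : iter u comp_shift a != 0.
  elim: u => //= u IH; rewrite -(rmorph0 shift); apply: contraNneq IH.
  by move/shift_inj->.
have sIk k x : I x -> I (iter (n * k) comp_shift x).
  elim: k => [|k IH] Ix; first by rewrite muln0.
  by rewrite mulnS iterD; apply/sI/IH.
pose b := \prod_(u < n) iter u comp_shift a.
have b0 : b != 0 by apply/prodf_neq0.
have iter_shift_prod q : iter q comp_shift b = \prod_(u < n) iter (q + u)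
  comp_shift a.
  elim: q => //= q ->; exact: (rmorph_prod shift).
have Ib q : I (iter q comp_shift b).
  (* Among the [n] consecutive shifts of [a] in the product, one has an exponent divisible by [n];
     it is in [I]. *)
  pose u := ((n - q %% n) %% n)%N.
  have un : (u < n)%N by rewrite ltn_pmod.
  have nqu : (n %| q + u)%N.
    rewrite /dvdn /u modnDmr {1}(divn_eq q n) -addnA.
    by rewrite subnKC ?modnDr ?modnMl // ltnW // ltn_pmod.
  rewrite iter_shift_prod; apply: (ideal_prod (i := Ordinal un)) => //=.
  by rewrite -(divnK nqu) mulnC; apply: sIk.
(* [N] is a difference ideal of [R]. It contains [val b], whose images under [s^i] project to [0]
   unless [l] divides [i]. *)
pose N := [set r | forall i, I (proj e (iter i s r))].
have : N 1.
  apply: (@simple_ideal1 _ _ s_simple N (val b)).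
  - split=> [i|c u v _ Nu Nv i]; first by rewrite iter0 rmorph0;
    apply: ideal_zero iI.
    have -> : iter i s (c * u + v) = iter i s c * iter i s u + iter i s v.
      by elim: (i) => //= k ->; rewrite rmorphD rmorphM.
    by rewrite rmorphD rmorphM; apply: (ideal_muladd _ iI);
      [apply: Nu|apply: Nv].
  - by move=> r Nr i; rewrite -iterSr; apply: Nr.
  - move=> i; have [/dvdnP[q ->]|li] := boolP (l %| i)%N.
      by rewrite mulnC -val_iter_comp_shift proj_val.
    have -> : proj e (iter i s (val b)) = 0.
      apply: val_inj; rewrite val_proj -[val b]compE iterM mulrA idem_ortho //
        mul0r.
      by rewrite -(rmorph0 (proj e)) val_proj mulr0.
    exact: ideal_zero iI.
  - by rewrite val_comp_eq0.
by move/(_ 0%N); rewrite /= rmorph1.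
Qed.

(** The denominators of [x] form a nonzero ideal of the component, stable under the power of the
    shift that fixes [x]; hence [1] is a denominator. *)
Lemma periodic_fraction_component n x : (0 < n)%N -> iter n sl x = x ->
  exists2 r : component e, x = r%:F & iter n comp_shift r = r.
Proof.
move=> n0 nx.
have [a [b [b0 xE]]] := fraction_quotient x.
pose I := [set d : component e | exists c : component e, d%:F * x = c%:F].
have [c] : I 1.
  apply: (@component_simple n I b) => //.
  - split; first by exists 0; rewrite !rmorph0 mul0r.
    move=> u v w _ [v' vx] [w' wx]; exists (u * v' + w').
    by rewrite !rmorphD !rmorphM mulrDl -mulrA vx wx.
  - move=> d [c dx]; exists (iter n comp_shift c).
    by rewrite -!component_frac_map_iter -{1}nx -iter_sigmaM dx.
  - by exists a; rewrite xE mulrCA divff ?mulr1 // tofrac_eq0.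
rewrite rmorph1 mul1r => xc; exists c => //.
by apply/eqP; rewrite -tofrac_eq -component_frac_map_iter -xc nx.
Qed.

Variables (C : fieldType) (h : {rmorphism C -> R}).
Hypothesis hP : forall x, s x = x <-> exists c, h c = x.

Let hF : {rmorphism C -> F} :=
  (@FracField.tofrac (component e) : {rmorphism _ -> _}) \o (proj e) \o h.

Let hFE c : hF c = (proj e (h c))%:F. Proof. by []. Qed.

Lemma fraction_combination k (r : 'I_k -> component e) (c : 'I_k -> C) :
  (proj e (\sum_i h (c i) * val (r i)))%:F = \sum_i hF (c i) * (r i)%:F.
Proof.
rewrite (raddf_sum (proj e)) (raddf_sum (@FracField.tofrac _)).
by apply: eq_bigr => i _; rewrite -[in RHS](proj_val (r i)) /= !rmorphM.
Qed.

Let iter_h i c : iter i s (h c) = h c.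
Proof. by elim: i => //= i ->; apply/hP; exists c. Qed.

(** An element [r] of the component fixed by [s^l] is the projection of the sum of its translates
    [s^i r], [i < l], which is a constant of [R]. *)
Lemma fixed_fractionsE : fixed_elements sl = range hF.
Proof.
apply/seteqP; split=> [x slx|_ [c _ <-]]; last first.
  rewrite /fixed_elements /= -[LHS]/(iter 1 sl _) component_frac_map_iter /=.
  congr (_%:F); apply: val_inj.
  by rewrite val_comp_shift !val_proj iterM (decomp_stable dec) iter_h.
have [r -> sr'] := @periodic_fraction_component 1 x isT slx.
have sr : iter l s (val r) = val r by rewrite -val_comp_shift;
  exact: congr1 sr'.
have l0 := decomp_gt0 dec.
pose c := \sum_(i < l) iter i s (val r).
have /hP[c' hc] : s c = c.
  rewrite /c rmorph_sum -(prednK l0) big_ord_recr big_ord_recl /= addrC;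
    congr (_ + _).
    by rewrite -iterS prednK.
exists c' => //; rewrite hFE hc; congr (_%:F); apply: val_inj;
  rewrite val_proj /c.
rewrite mulr_sumr (bigD1 (Ordinal l0)) //= compE big1 ?addr0 // => i i0.
rewrite -[val r]compE iterM mulrA idem_ortho ?mul0r //.
apply: contra i0 => li; apply/eqP/val_inj => /=.
by apply/eqP; move: li; rewrite /dvdn modn_small.
Qed.

Lemma degree_lin_dim :
  degree (fixed_elements sl) (periodic_elements sl) =
    lin_dim hF (periodic_elements sl).
Proof.
rewrite /degree /lin_dim; congr (xget None [set Some n | n in _]).
apply/seteqP; split=> n /= [b].
  case=> bD fb Sb; exists b; split=> // [c c0 i|x Dx].
    apply: (fmorph_inj hF); rewrite rmorph0; apply: (fb (hF \o c)) => // i'.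
    by rewrite fixed_fractionsE; exists (c i').
  have [c Ec ->] := Sb x Dx.
  have /fin_all_exists[d cd] i : exists d, hF d = c i.
    by have := Ec i; rewrite fixed_fractionsE => -[d _ <-]; exists d.
  by exists d; apply: eq_bigr => i _; rewrite cd.
case=> bD fb Sb; exists b; split=> // [c Ec c0 i|x Dx].
  have /fin_all_exists[d cd] i' : exists d, hF d = c i'.
    by have := Ec i'; rewrite fixed_fractionsE => -[d _ <-]; exists d.
  rewrite -cd (fb d) ?rmorph0 // -[RHS]c0.
  by apply: eq_bigr => i' _; rewrite cd.
have [c ->] := Sb x Dx; exists (hF \o c) => // i.
by rewrite fixed_fractionsE; exists (c i).
Qed.

(** The basis consists of the translates by [s^i], [i < l], of a basis in the first component, one
    copy for each component. *)
Lemma component_basis k (b : 'I_k -> F) : lin_basis hF (periodic_elements sl) b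
  ->
  exists b' : 'I_(l * k) -> R, lin_basis h (periodic_elements s) b'.
Proof.
move=> [bD fb Sb]; have l0 := decomp_gt0 dec.
have /fin_all_exists[r rP] i : exists r : component e,
    b i = r%:F /\ exists2 M, (0 < M)%N & iter M comp_shift r = r.
  have [M M0 bM] := bD i.
  have [r br rM] := periodic_fraction_component M0 bM.
  by exists r; split=> //; exists M.
suff bas : lin_basis h (periodic_elements s)
    (fun ik : 'I_l * 'I_k => iter ik.1 s (val (r ik.2))).
  by apply: (lin_basis_reindex bas); rewrite card_prod !card_ord.
split.
- move=> [i i'] /=; have [_ [M M0 rM]] := rP i'.
  exists (l * M)%N; first by rewrite muln_gt0 l0.
  by rewrite -iterD addnC iterD -val_iter_comp_shift rM.
- move=> c c0 [i0 i']; apply: (fb (fun k => c (i0, k))).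
  have {}c0 : \sum_i \sum_k0 h (c (i, k0)) * iter i s (val (r k0)) = 0.
    by rewrite pair_bigA -[RHS]c0; apply: eq_bigr => -[].
  have : iter i0 s (\sum_k0 h (c (i0, k0)) * val (r k0)) = iter i0 s 0.
    rewrite iter0 -[RHS](mulr0 (iter i0 s (idem_val e))) -[in RHS]c0.
    have iter_sum (G : 'I_k -> R) n : iter n s (\sum_k0 G k0) =
      \sum_k0 iter n s (G k0).
      by elim: n => //= n ->; rewrite rmorph_sum.
    rewrite mulr_sumr (bigD1 i0) //= [X in _ = _ + X]big1 ?addr0.
      rewrite iter_sum mulr_sumr; apply: eq_bigr => k0 _.
      by rewrite iterM iter_h mulrCA -iterM compE.
    move=> i ii0; rewrite mulr_sumr big1 // => k0 _.
    rewrite -[val (r k0)]compE iterM mulrCA [X in _ * X]mulrA (decomp_ortho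
      dec) ?mul0r ?mulr0 //.
    by apply: contra ii0 => /eqP/val_inj->.
  move/iter_inj => cr0; transitivity ((proj e 0)%:F); last by rewrite !rmorph0.
  rewrite -cr0 fraction_combination.
  by apply: eq_bigr => k0 _; have [-> _] := rP k0.
- move=> x [M M0 xM].
  have xlM : iter (l * M) s x = x.
    rewrite mulnC; elim: (l) => [|l' IH]; first by rewrite muln0.
    by rewrite mulnS iterD IH.
  (* [w i] is the part of [x] in component [i], brought back to the first one: as [x] has period
     [l * M], the exponent [l * M - i] acts on it as [-i]. *)
  pose w i := idem_val e * iter (l * M - i)%N s x.
  have ew i : idem_val e * w i = w i by rewrite mulrA idem_valM.
  have wM i : iter (l * M) s (w i) = w i.
    by rewrite iterM iter_e -iterD addnC iterD xlM.
  have sw i : (i < l)%N -> iter i s (w i) = iter i s (idem_val e) * x.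
    move=> il; rewrite iterM -iterD subnKC ?xlM //.
    by rewrite (leq_trans (ltnW il)) // leq_pmulr.
  have /fin_all_exists[d wd] (i : 'I_l) : exists d : 'I_k -> C,
      w i = \sum_k0 h (d k0) * val (r k0).
    have [|d wd] := Sb (proj e (w i))%:F.
      exists M => //; rewrite component_frac_map_iter; congr (_%:F).
      by apply: val_inj; rewrite val_iter_comp_shift val_projK.
    exists d; have : proj e (w i) = proj e (\sum_k0 h (d k0) * val (r k0)).
      apply/eqP; rewrite -tofrac_eq wd fraction_combination; apply/eqP.
      by apply: eq_bigr => k0 _; have [-> _] := rP k0.
    move=> pE; rewrite -(val_projK (ew i)) -[RHS]val_projK;
      first exact: congr1 pE.
    by rewrite mulr_sumr; apply: eq_bigr => k0 _; rewrite mulrCA compE.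
  exists (fun ik => d ik.1 ik.2).
  rewrite -[LHS]mul1r -(decomp_sum dec) mulr_suml.
  rewrite -(pair_bigA _ (fun i k0 => h (d i k0) * iter i s (val (r k0)))) /=.
  apply: eq_bigr => i _; rewrite -sw // wd.
  elim: (nat_of_ord i) => // n IH.
  rewrite iterS IH rmorph_sum; apply: eq_bigr => k0 _; rewrite rmorphM.
  by congr (_ * _); apply: (iter_h 1).
Qed.

Lemma lin_dim_component :
  omap (muln l) (lin_dim hF (periodic_elements sl)) =
    lin_dim h (periodic_elements s).
Proof.
have [[k [b Rb]]|nR] :=
    pselect (exists k (b : 'I_k -> R), lin_basis h (periodic_elements s) b);
      last first.
  rewrite /lin_dim [RHS]xgetPN; last by move=> _ [k [b Rb] _]; apply: nR;
    exists k, b.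
  rewrite xgetPN // => _ [k [b /component_basis[b' Rb']] _].
  by apply: nR; exists (l * k)%N, b'.
have [|k' [b' Fb']] := @lin_basis_exists _ _ hF (periodic_elements sl) k.
  move=> k' b' Db' fb'.
  have /fin_all_exists[r rP] i : exists r : component e,
      b' i = r%:F /\ exists2 M, (0 < M)%N & iter M comp_shift r = r.
    have [M M0 bM] := Db' i.
    have [r br rM] := periodic_fraction_component M0 bM.
    by exists r; split=> //; exists M.
  have fr : lin_free h (fun i => val (r i)).
    move=> c c0; apply: fb'.
    transitivity ((proj e 0)%:F); last by rewrite !rmorph0.
    rewrite -c0 fraction_combination.
    by apply: eq_bigr => k0 _; have [-> _] := rP k0.
  have [_ _ SRb] := Rb.
  rewrite -(card_ord k') -(card_ord k); apply: (lin_free_card fr (b' := b)) =>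
    i.
  apply: SRb; have [_ [M M0 rM]] := rP i.
  exists (l * M)%N; first by rewrite muln_gt0 (decomp_gt0 dec).
  by rewrite -val_iter_comp_shift rM.
have [b'' Rb''] := component_basis Fb'.
by rewrite (lin_dimE Fb') (lin_dimE Rb'').
Qed.

Variables (K : fieldType) (sK : {rmorphism K -> K}) (iota : {rmorphism K -> R}).
Hypothesis iota_ext : forall a, s (iota a) = iota (sK a).
Hypothesis CK_DK : fixed_elements sK = periodic_elements sK.

Lemma m_valueE : m_value sK iota s l e = lin_dim h (periodic_elements s).
Proof.
rewrite /m_value -lin_dim_component -degree_lin_dim;
  congr (omap _ (degree _ _)).
(* The fixed elements form a subfield, and it contains the image of [D_K] because [D_K = C_K]
   consists of constants. *)
apply/seteqP; split=> [x|x slx S [_ ES]]; last by apply: ES; right.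
apply; split; last first.
  move=> y [[a + <-]|//]; rewrite -CK_DK => /= sKa.
  have /hP[c hc] : s (iota a) = iota a by rewrite iota_ext sKa.
  by rewrite fixed_fractionsE; exists c; rewrite // hFE hc.
split=> [|u v|u v]; rewrite ?in_setE //=.
- exact: (rmorph1 sigma).
- by move=> su sv; apply: (etrans (rmorphB sigma u v)); rewrite /= su sv.
- by move=> su sv; apply: (etrans (fmorph_div sigma u v)); rewrite /= su sv.
Qed.

End Component.

(** Both values on the right are expressed by [S], [sS] and [g] alone, so applying this to two
    Picard-Vessiot rings inside the same [S] compares their invariants. *)
Lemma pv_invariants (K : fieldType) (sK : {rmorphism K -> K})
    (CK_DK : fixed_elements sK = periodic_elements sK)
    (n : nat) (A : 'M[K]_n) (R S : comNzRingType)
    (iota : {rmorphism K -> R}) (s : {rmorphism R -> R})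
    (sS : {rmorphism S -> S}) (j : {rmorphism R -> S})
    (L : fieldType) (g : {rmorphism L -> S}) :
  picard_vessiot sK A iota s ->
  (forall x, j (s x) = sS (j x)) ->
  (forall y, sS y = y <-> exists c, g c = y) ->
  (exists2 l : seq S, forall z, z \in l -> sS z = z &
    forall T : {pred S}, GRing.subring_closed T ->
      (forall x, j x \in T) -> {subset l <= T} -> forall x, x \in T) ->
  krull_dim R = krull_dim S /\
  is_m_invariant sK iota s (lin_dim g (periodic_elements sS)).
Proof.
move=> PV js gP [l l_const l_gen].
have [s_bij ext _ s_simple] := PV.
have [C [h hP]] := constants_field s_simple.
split.
  apply: (krull_dim_integral (simple_inj s_simple js)).
  exact: (extension_of_constants_integral s_simple js hP gP l_const l_gen).
split=> [|k e dec].
  exact: idempotent_decomposition_exists s_simple s_bij (noetherian_pv PV).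
rewrite -(lin_dim_extension s_simple js hP gP l_const l_gen).
exact: (m_valueE (bij_inj s_bij) dec s_simple hP ext CK_DK).
Qed.

Local Close Scope classical_set_scope.

Theorem proposition4p9 (K : fieldType) (sK : {rmorphism K -> K})
    (sK_bij : bijective sK)
    (K_char0 : [pchar K] =i pred0)
    (CK_DK : fixed_elements sK = periodic_elements sK)
    (n : nat) (A : 'M[K]_n) (A_unit : A \in unitmx)
    (R1 : comNzRingType) (iota1 : {rmorphism K -> R1})
    (s1 : {rmorphism R1 -> R1}) (PV1 : picard_vessiot sK A iota1 s1)
    (R2 : comNzRingType) (iota2 : {rmorphism K -> R2})
    (s2 : {rmorphism R2 -> R2}) (PV2 : picard_vessiot sK A iota2 s2) :
  krull_dim R1 = krull_dim R2 /\
  exists m : option nat,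
    is_m_invariant sK iota1 s1 m /\ is_m_invariant sK iota2 s2 m.
Proof.
have [S [sS [j1 [j2 [S_simple [j1s j2s] j12 genS]]]]] :=
  simple_compositum (pv_extension PV1) (pv_extension PV2).
have [L [g gP]] := constants_field S_simple.
have gen1 := pv_constant_generators A_unit PV1 PV2 j1s j2s j12 genS.
have gen2 := pv_constant_generators A_unit PV2 PV1 j2s j1s (fun a => esym (j12
  a))
  (fun T T_sub T2 T1 => genS T T_sub T1 T2).
have [-> m1] := pv_invariants CK_DK PV1 j1s gP gen1.
have [-> m2] := pv_invariants CK_DK PV2 j2s gP gen2.
by split=> //; exists (lin_dim g (periodic_elements sS)).
Qed.
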